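(* Let $p\in(1,\infty)$. There is a constant $C_p$ depending only on $p$ such that for all functions $g\in C(X)$ and all strictly positive supersolutions $u$ of $Q'[\varphi]=0$ on $X$, $$\|g\|_{\mathcal H,u}\le \|g\|_{\mathcal H}\le C_p\,\|g\|_{\mathcal H,u}.$$
   Context: Setting: $X$ is an infinite countable set with the discrete topology, so compact subsets are the finite ones, and $K\Subset X$ means that $K$ is a finite subset of $X$. $m:X\to(0,\infty)$ is a measure of full support. $C(X)$ is the set of all functions $X\to\mathbb{R}$ and $C_c(X)$ the set of finitely supported ones. For a function $f$ on $X$ and $A\subseteq X$ write $\sum_A f=\sum_{x\in A}f(x)$, and $1_A$ denotes the characteristic function of $A$. $b$ is a connected graph over $(X,m)$: $b:X\times X\to[0,\infty)$ is symmetric, has zero diagonal, satisfies $\sum_{y\in X}b(x,y)<\infty$ for all $x\in X$ (it need not be locally finite), and any two vertices are joined by a finite path $x_0,\dots,x_n$ with $b(x_{i-1},x_i)>0$. $c:X\to\mathbb{R}$ is a potential. Write $\nabla_{xy}f=f(x)-f(y)$. The energy functional is $$Q(\varphi)=\tfrac12\sum_{x,y\in X}b(x,y)|\nabla_{xy}\varphi|^p+\sum_{x\in X}c(x)|\varphi(x)|^p,\quad \varphi\in C_c(X),$$ and it is assumed throughout that $Q(\varphi)\ge0$ for all $\varphi\in C_c(X)$. Let $\mathcal F(X)=\{f\in C(X): \sum_{y\in X} b(x,y)|\nabla_{xy}f|^{p-1}<\infty \text{ for all }x\in X\}$ and, for $f\in\mathcal F(X)$, $$Q'[f](x)=\frac1{m(x)}\sum_{y\in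 X}b(x,y)|\nabla_{xy}f|^{p-2}\nabla_{xy}f+\frac{c(x)}{m(x)}|f(x)|^{p-2}f(x)$$ (with $|0|^{p-2}0=0$). A function $u\in\mathcal F(X)$ is a supersolution of $Q'[\varphi]=0$ on $X$ if $Q'[u]\ge0$ on $X$; strictly positive means $u(x)>0$ for all $x\in X$. Norms: for $g\in C(X)$ the Hardy constant $C(g)$ is the best (largest) constant $C\ge 0$ such that $C\sum_X m|g||\varphi|^p\le Q(\varphi)$ for all $\varphi\in C_c(X)$, and $\|g\|_{\mathcal H}$ is its reciprocal, i.e. $$\|g\|_{\mathcal H}=\sup_{\varphi\in C_c(X),\ Q(\varphi)\neq0}\frac{\sum_X m|\varphi|^p|g|}{Q(\varphi)}=\frac1{C(g)}.$$ For a strictly positive $u\in C(X)$ and $K\Subset X$, the $Q$-capacity of $K$ with respect to $u$ is $$\mathrm{Cap}_u(K)=\inf\{Q(\varphi):\varphi\in C_c(X),\ \varphi\ge 1_K u\},$$ and for $g\in C(X)$ $$\|g\|_{\mathcal H,u}=\sup_{K\Subset X,\ \mathrm{Cap}_u(K)\neq0}\frac{\sum_K m\,u^p|g|}{\mathrm{Cap}_u(K)}\in[0,\infty].$$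
   Formalization: The norm ‖g‖_{H,u} is taken over all finite K with 0/0 = 0 and a/0 = ∞ for a > 0, not only over K with Cap_u(K) ≠ 0; as written the upper bound fails when all capacities vanish (e.g. the line graph Z with c = 0, u = 1). *)

(* Defs.v *)
From HB Require Import structures.
From mathcomp Require Import all_boot all_order all_algebra.
From mathcomp Require Import all_classical all_reals all_analysis.
Set Implicit Arguments.
Unset Strict Implicit.
Unset Printing Implicit Defensive.
Import Order.TTheory GRing.Theory Num.Theory.
Local Open Scope classical_set_scope.
Local Open Scope ring_scope.

Section defs.
Variables (R : realType) (X : countType).
Implicit Types (m c f g u phi : X -> R) (b : X -> X -> R) (K : set X) (p : R).

Record connected_graph b : Prop := ConnectedGraph {
  graph_ge0 : forall x y, 0 <= b x y;
  graph_sym : forall x y, b x y = b y x;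
  graph_diag : forall x, b x x = 0;
  graph_sum : forall x, (\esum_(y in [set: X]) (b x y)%:E < +oo)%E;
  graph_conn : forall x y, exists s : seq X,
    path (fun v w => 0 < b v w) x s /\ last x s = y
}.

Definition Cc phi : Prop := finite_set [set x | phi x != 0].

(* The edge sum is an unordered sum of nonnegative terms; for finitely
   supported phi it is finite, and the potential part is a finite sum. *)
Definition energy p b c phi : \bar R :=
  ((2^-1)%:E *
     (\esum_(z in [set: X * X]) (b z.1 z.2 * `|phi z.1 - phi z.2| `^ p)%:E)
   + (\sum_(x \in [set: X]) c x * `|phi x| `^ p)%:E)%E.

Definition Fdom p b f : Prop :=
  forall x, (\esum_(y in [set: X]) (b x y * `|f x - f y| `^ (p - 1))%:E < +oo)%E.

(* Sum of an absolutely summable real family (positive minus negative part). *)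
Definition abs_sum (F : X -> R) : R :=
  fine (\esum_(y in [set: X]) (Num.max (F y) 0)%:E)
  - fine (\esum_(y in [set: X]) (Num.max (- F y) 0)%:E).

(* Since 0 `^ r * 0 = 0 for every r, the convention |0|^(p-2) 0 = 0 holds. *)
Definition energy' p m b c f (x : X) : R :=
  (m x)^-1 *
    abs_sum (fun y => b x y * (`|f x - f y| `^ (p - 2) * (f x - f y)))
  + c x / m x * (`|f x| `^ (p - 2) * f x).

Definition supersolution p m b c u : Prop :=
  Fdom p b u /\ forall x, 0 <= energy' p m b c u x.

Definition hardy_norm p m b c g : \bar R :=
  ereal_sup [set ((\sum_(x \in [set: X]) m x * `|phi x| `^ p * `|g x|)%:E
                  / energy p b c phi)%E
            | phi in [set phi | Cc phi /\ energy p b c phi != 0%E]].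

Definition cap p b c u K : \bar R :=
  ereal_inf [set energy p b c phi
            | phi in [set phi | Cc phi /\ forall x, \1_K x * u x <= phi x]].

Definition cap_quot p m b c u g K : \bar R :=
  ((\sum_(x \in K) m x * u x `^ p * `|g x|)%:E / cap p b c u K)%E.

(* In \bar R, 0 / 0 = 0 and a / 0 = +oo for a > 0.  Thus a set K of zero
   capacity contributes nothing if m u^p |g| vanishes on K, and makes the norm
   infinite otherwise.  Restricting the supremum to sets of nonzero capacity
   is the same as long as nonempty sets have nonzero capacity (cap_normE).  It
   is not in the critical case: for the line graph on Z with b = 1 on edges,
   m = 1, c = 0, u = 1, all capacities vanish, the restricted supremum would
   be that of the empty set for every g, while hardy_norm of 1_{0} is +oo. *)
Definition cap_norm p m b c u g : \bar R :=
  ereal_sup [set cap_quot p m b c u g K | K in [set K | finite_set K]].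

Lemma cap_normE p m b c u g :
    [set: X] !=set0 -> (forall x, 0 < m x) -> (forall x, 0 < u x) ->
    (forall phi, Cc phi -> (0 <= energy p b c phi)%E) ->
    (forall K, finite_set K -> K !=set0 -> cap p b c u K != 0%E) ->
  cap_norm p m b c u g =
  ereal_sup [set cap_quot p m b c u g K
            | K in [set K | finite_set K /\ cap p b c u K != 0%E]].
Proof.
move=> [x0 _] m0 u0 Q0 cap0; apply/eqP; rewrite eq_le; apply/andP; split.
- apply: ge_ereal_sup => _ [K /= finK <-].
  have [->|K0] := eqVneq K set0; last first.
    apply: ereal_sup_ubound; exists K => //; split => //.
    by apply: cap0 => //; exact/set0P.
  rewrite {1}/cap_quot fsbig_set0 mul0e.
  apply: (@le_trans _ _ (cap_quot p m b c u g [set x0])).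
    rewrite /cap_quot fsbig_set1; apply: mule_ge0.
      by rewrite lee_fin !mulr_ge0 ?powR_ge0 ?(ltW (m0 _)).
    by rewrite inve_ge0; apply: le_ereal_inf_tmp => _ [phi [/Q0 ? _] <-].
  apply: ereal_sup_ubound; exists [set x0] => //; split => //.
  by apply: cap0 => //; exists x0.
- apply: ereal_sup_le => _ [K [finK _] <-].
  by exists K.
Qed.

End defs.

(* Main.v *)
(** Write [phi = u psi]. On an edge, [|phi x - phi y|^p] splits into the gap
    [picone] of Picone's inequality and a first-order part; summing the latter
    over all edges gives the ground state representation
      [Q (u psi) = 1/2 sum b picone (psi x, psi y) + sum m Q'[u] u |psi|^p],
    whose two sums are nonnegative since [u] is a supersolution.

    For the upper bound, take the level sets [{psi >= lam}] for [lam = l 2^k].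
    The function [u * sqtrunc (psi / lam)] with [sqtrunc s = min (s^2, 1)] is
    admissible for the capacity, so Maz'ya's truncation argument reduces the
    claim to [sum_k lam^p Q (u * sqtrunc (psi / lam)) <= C Q (u psi)]. In both
    sums of the representation the [k]-th term is at most a constant times
    [min (psi/lam, lam/psi)] times the original one, and these factors have a
    bounded sum over [k]. For [picone a b 1 r] this rests on two properties,
    both read off its derivative in [r] and uniform in [a, b >= 0]:
    it is nonincreasing on [0, 1], and its value at [r^2] is at most a constant
    times its value at [r].

    For the lower bound a test function for the capacity is also one for the
    Hardy quotient, provided its energy is not zero. If [Q (u psi) = 0] then
    [picone] vanishes on all edges, but [picone a b s 0 > 0] for [s > 0], so the
    support of [psi] is empty or, by connectedness, the whole infinite graph. *)
Require Import Defs.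
From mathcomp Require Import all_boot all_order all_algebra.
From mathcomp Require Import all_classical all_reals all_analysis.
From mathcomp Require Import ring lra.
Set Implicit Arguments.
Unset Strict Implicit.
Unset Printing Implicit Defensive.
Import Order.TTheory GRing.Theory Num.Theory numFieldNormedType.Exports.
Local Open Scope classical_set_scope.
Local Open Scope ring_scope.

(** * The nonlinearity $h(z)=|z|^{p-2}z$ of the $p$-Laplacian and its increments *)

Definition plap {R : realType} (p z : R) : R := `|z| `^ (p - 2) * z.

Section plap_theory.
Context {R : realType} {p : R}.
Hypothesis p1 : 1 < p.
Local Notation h := (plap p).
Implicit Types a r z A B : R.

Lemma plapN z : h (- z) = - h z.
Proof. by rewrite /plap normrN mulrN. Qed.

Lemma plap0 : h 0 = 0.
Proof. by rewrite /plap mulr0. Qed.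

Lemma ge0_plap z : 0 <= z -> h z = z `^ (p - 1).
Proof.
move=> z0; rewrite /plap ger0_norm// mulrC.
have -> : p - 2 = (p - 1) - 1 by ring.
by rewrite mulr_powRB1// subr_gt0.
Qed.

Lemma plap_ge0 z : 0 <= z -> 0 <= h z.
Proof. by move=> z0; rewrite ge0_plap// powR_ge0. Qed.

Lemma norm_plap z : `|h z| = `|z| `^ (p - 1).
Proof.
by rewrite -ge0_plap// /plap normrM normr_id (ger0_norm (powR_ge0 _ _)).
Qed.

Lemma plapM a z : 0 <= a -> h (a * z) = a `^ (p - 1) * h z.
Proof.
move=> a0; rewrite -ge0_plap// /plap normrM (ger0_norm a0) powRM//.
ring.
Qed.

Lemma plap_mulr z : h z * z = `|z| `^ p.
Proof.
have p0 : 0 < p by exact: lt_trans p1.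
rewrite /plap -mulrA -expr2 -real_normK ?num_real// expr2 mulrCA.
have -> : p - 2 = (p - 1) - 1 by ring.
by rewrite [_ `^ _ * _]mulrC mulr_powRB1 ?subr_gt0// mulr_powRB1.
Qed.

Lemma cvg_plap0 : h t @[t --> 0^'] --> (0 : R).
Proof.
apply/norm_cvg0P; under eq_fun do rewrite norm_plap.
apply: (@cvg_comp _ _ _ (@Num.norm R R) (@powR R ^~ (p - 1)) _ 0^'+); last first.
  by apply: powR_cvg0; rewrite subr_gt0.
move=> P [e /= e0 eP]; exists e => //= t; rewrite /ball_/= => te t0.
by apply: eP; rewrite /ball_/= ?normr_gt0// sub0r normrN normr_id -normrN -sub0r.
Qed.

Lemma is_derive_norm_powR z : is_derive z 1 (fun t => `|t| `^ p) (p * h z).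
Proof.
have p0 : 0 < p by exact: lt_trans p1.
have [z0|z0|->] := ltgtP z 0.
- have : is_derive z 1 ((@powR R ^~ p) \o -%R) (p * (- z) `^ (p - 1) * -1).
    apply: is_derive1_comp.
    by apply: is_derive1_powR; rewrite oppr_gt0.
  rewrite -ge0_plap ?oppr_ge0 ?ltW// plapN mulrN1 mulrN opprK.
  apply: near_eq_is_derive.
  by near=> t; rewrite /= ltr0_norm//; near: t; exact: lt_nbhsl.
- have : is_derive z 1 (@powR R ^~ p) (p * z `^ (p - 1)) by exact: is_derive1_powR.
  rewrite -ge0_plap ?ltW//.
  apply: near_eq_is_derive.
  by near=> t; rewrite /= gtr0_norm//; near: t; exact: lt_nbhsr.
- rewrite plap0 mulr0.
  (* At 0 the difference quotient of $|t|^p$ is $|t|^p/t=h(t)$, which tends to 0 by [cvg_plap0]. *)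
  have H : h0^-1 *: (((fun t => `|t| `^ p) \o shift 0) (h0 *: (1 : R)) -
       (fun t => `|t| `^ p) (0 : R)) @[h0 --> 0^'] --> (0 : R).
    apply: cvg_trans cvg_plap0; apply: near_eq_cvg; near=> t.
    have t0 : t != 0 by near: t; exact: nbhs_dnbhs_neq.
    rewrite /= normr0 powR0 ?gt_eqF// subr0 addr0 /GRing.scale/= mulr1.
    by rewrite -plap_mulr mulrCA mulVf// mulr1.
  by split; [apply/cvg_ex; exists 0|exact/cvg_lim].
Unshelve. all: by end_near.
Qed.

(** By the mean value theorem $1-r^q=q x^{q-1}(1-r)$ with $r<x<1$, which yields the bound with
    factor $q$; the bound with factor 1 compares $r^q$ with $r$. Which of them is the upper one
    depends on whether $q\le1$. *)
Lemma powR_onem_bounds (q r : R) : 0 < q -> 0 <= r <= 1 ->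
  Num.min q 1 * (1 - r) <= 1 - r `^ q <= Num.max q 1 * (1 - r).
Proof.
move=> q0 /andP[]; rewrite le_eqVlt => /predU1P[<- _|r0].
  by rewrite powR0 ?gt_eqF// !subr0 !mulr1 ge_min lexx le_max lexx !orbT.
rewrite le_eqVlt => /predU1P[->|r1].
  by rewrite powR1 !subrr !mulr0 lexx.
have dp (x : R) : 0 < x -> is_derive x 1 (@powR R ^~ q) (q * x `^ (q - 1)).
  by move=> x0; exact: is_derive1_powR.
have [||x] := @MVT R (@powR R ^~ q) (fun x => q * x `^ (q - 1)) r 1 r1.
- by move=> x; rewrite in_itv/= => /andP[rx _]; apply: dp; exact: lt_trans rx.
- apply: derivable_within_continuous => x; rewrite in_itv/= => /andP[rx _].
  by apply: ex_derive; apply: dp; exact: lt_le_trans rx.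
rewrite in_itv/= powR1 => /andP[rx x1] rq.
have r10 : 0 <= 1 - r by rewrite subr_ge0 ltW.
have r01 : 0 < r <= 1 by rewrite r0 ltW.
have x01 : 0 < x <= 1 by rewrite (lt_trans r0)//= ltW.
have [q1|/ltW q1] := leP q 1; apply/andP; split.
- rewrite rq; apply: ler_wpM2r => //; rewrite ler_peMr ?(ltW q0)//.
  by rewrite -[leLHS](powRr0 x); apply: ger_powR => //; rewrite subr_le0.
- by rewrite mul1r lerB// ger1_powR.
- by rewrite mul1r lerB// ge1r_powR.
- rewrite rq; apply: ler_wpM2r => //; rewrite ler_piMr ?(ltW q0)//.
  by rewrite -[leRHS](powRr0 x); apply: ger_powR => //; rewrite subr_ge0.
Qed.

(** For $r\ge0$ this is [powR_onem_bounds] with exponent $p-1$; for $r\le0$ both $1-r$ and $1-h(r)$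
    lie in $[1,2]$, whence the constants $1/2$ and 2. *)
Lemma plap_onem_bounds : exists c C : R, [/\ 0 < c, 0 < C &
  forall r, -1 <= r <= 1 -> c * (1 - r) <= 1 - h r <= C * (1 - r)].
Proof.
have q0 : 0 < p - 1 by rewrite subr_gt0.
exists (Num.min (Num.min (p - 1) 1) 2^-1), (Num.max (Num.max (p - 1) 1) 2).
split; first by rewrite !lt_min q0 ltr01 invr_gt0 ltr0n.
  by rewrite !lt_max q0.
move=> r /andP[r1 r2]; have r10 : 0 <= 1 - r by rewrite subr_ge0.
have [r0|/ltW r0] := leP 0 r.
  have /andP[lo up] : Num.min (p - 1) 1 * (1 - r) <= 1 - h r <=
      Num.max (p - 1) 1 * (1 - r).
    by rewrite ge0_plap// powR_onem_bounds// r0.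
  rewrite (le_trans _ lo) ?(le_trans up)//; apply: ler_wpM2r => //.
    by rewrite le_max lexx.
  by rewrite ge_min lexx.
have : 0 <= - h r <= 1.
  rewrite -plapN plap_ge0 ?oppr_ge0//= ge0_plap ?oppr_ge0//.
  have nr : 0 <= - r <= 1 by rewrite oppr_ge0 r0 lerNl.
  case/andP: nr => nr0 nr1.
  apply: (@le_trans _ _ (1 `^ (p - 1))); last by rewrite powR1.
  by apply: ge0_ler_powR; rewrite ?nnegrE ?(ltW q0).
move=> /andP[h0 h1]; apply/andP; split.
  apply: (@le_trans _ _ (2^-1 * (1 - r))); last by lra.
  by apply: ler_wpM2r => //; rewrite ge_min lexx orbT.
apply: (@le_trans _ _ (2 * (1 - r))); first by lra.
by apply: ler_wpM2r => //; rewrite le_max lexx orbT.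
Qed.

(** Increments of $h$ behave like those of a linear map of slope $\max(|A|,|B|)^{p-2}$, for $p<2$ as
    for $p>2$. If $|B|\le A$, homogeneity reduces this to [plap_onem_bounds] at $B/A$; otherwise
    oddness allows $(A,B)$ to be replaced by $(-B,-A)$. *)
Lemma plap_diff_bounds : exists c C : R, [/\ 0 < c, 0 < C &
  forall A B, B <= A ->
    c * ((A - B) * Num.max `|A| `|B| `^ (p - 2)) <= h A - h B
      <= C * ((A - B) * Num.max `|A| `|B| `^ (p - 2))].
Proof.
have [c [C [c0 C0 H]]] := plap_onem_bounds; exists c, C; split => //.
have main A B : `|B| <= A ->
    c * ((A - B) * A `^ (p - 2)) <= h A - h B <= C * ((A - B) * A `^ (p - 2)).
  move=> BA; have : 0 <= A by apply: le_trans BA.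
  rewrite le_eqVlt => /predU1P[A0|A0].
    have -> : B = 0 by apply/eqP; rewrite -normr_le0 A0.
    by rewrite -A0 !subrr mul0r !mulr0 lexx.
  have hB : -1 <= B / A <= 1.
    move: BA; rewrite ler_norml => /andP[AB BA].
    by rewrite ler_pdivlMr// ler_pdivrMr// mul1r mulN1r AB.
  have E (k : R) : k * ((A - B) * A `^ (p - 2)) = A `^ (p - 1) * (k * (1 - B / A)).
    have -> : A `^ (p - 1) = A * A `^ (p - 2).
      have -> : p - 2 = (p - 1) - 1 by ring.
      by rewrite mulr_powRB1// ?subr_gt0// ltW.
    field; exact: lt0r_neq0.
  have -> : h A - h B = A `^ (p - 1) * (1 - h (B / A)).
    by rewrite mulrBr mulr1 -ge0_plap ?ltW// ge0_plap ?ltW// -plapM ?ltW// mulrC divfK// lt0r_neq0.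
  by rewrite !E !ler_pM2l ?powR_gt0//; exact: H.
move=> A B BA; have [AB|AB] := leP 0 (A + B).
  have BnA : `|B| <= A by rewrite ler_norml; lra.
  have -> : Num.max `|A| `|B| = A.
    have A0 : 0 <= A by apply: le_trans BnA.
    by rewrite ger0_norm//; apply/max_idPl.
  exact: main.
have BnA : `|- A| <= - B by rewrite normrN ler_norml; lra.
have -> : Num.max `|A| `|B| = - B.
  have B0 : 0 <= - B by apply: le_trans BnA.
  by rewrite -(normrN B) (ger0_norm B0); apply/max_idPr; rewrite -normrN.
have := main _ _ BnA; rewrite !plapN !opprK.
by rewrite (addrC (- B)) (addrC (- h B)).
Qed.
End plap_theory.

(** * The gap in Picone's inequality and its monotonicity *)

Lemma le0_ger_powR {R : realType} (r x y : R) : r <= 0 -> 0 < x -> x <= y ->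
  y `^ r <= x `^ r.
Proof.
move=> r0 x0 xy; have y0 : 0 < y by exact: lt_le_trans xy.
rewrite -[r]opprK 2!(powRN _ (- r)) lef_pV2 ?posrE ?powR_gt0//.
by apply: ge0_ler_powR; rewrite ?nnegrE ?oppr_ge0 ?(ltW x0) ?(ltW y0).
Qed.

(** Only [s, t >= 0] matters; the absolute values make [picone p a b 1] everywhere
    differentiable. *)
Definition picone {R : realType} (p a b s t : R) : R :=
  `|a * s - b * t| `^ p - plap p (a - b) * (a * `|s| `^ p - b * `|t| `^ p).

Section picone_theory.
Context {R : realType} {p : R}.
Hypothesis p1 : 1 < p.
Local Notation h := (plap p).
Implicit Types a b r v w x y d : R.

Lemma plap_le x y : x <= y -> h x <= h y.
Proof.
move=> xy; have [c [C [c0 _ H]]] := plap_diff_bounds p1.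
have /andP[+ _] := H _ _ xy; rewrite -[h x <= h y]subr_ge0; apply: le_trans.
by rewrite !mulr_ge0 ?powR_ge0 ?subr_ge0// ltW.
Qed.

Lemma plap_lt x y : x < y -> h x < h y.
Proof.
move=> xy; have [c [C [c0 _ H]]] := plap_diff_bounds p1.
have /andP[+ _] := H _ _ (ltW xy); rewrite -[h x < h y]subr_gt0.
apply: lt_le_trans; rewrite !mulr_gt0 ?subr_gt0// powR_gt0// lt_max !normr_gt0.
by apply/orP; have [y0|] := eqVneq y 0; [right|left]; rewrite // lt_eqF// -y0.
Qed.

(** With [x = (a - b) w] and [d = a (1 - w)] this compares the derivatives in [w] of
    [picone p a b 1 (w ^+ 2)] and [picone p a b 1 w]. *)
Lemma plap_diff_scale : exists2 C : R, 0 < C &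
  forall x d w, 0 <= d -> 0 <= w <= 1 ->
    w * (h (w * x + (1 + w) * d) - h (w * x)) <= C * (h (x + d) - h x).
Proof.
have [c [C [c0 C0 H]]] := plap_diff_bounds p1.
(* The numbers 5 and $1/3$ come from $wM/3\le M_2\le 5M$ below; the first serves for $p\ge2$, the
   second for $p\le2$. *)
pose K := Num.max (5 `^ (p - 2)) (3^-1 `^ (p - 2)) : R.
have K0 : 0 < K by rewrite lt_max powR_gt0.
exists (2 * C * K / c); first by rewrite divr_gt0// !mulr_gt0.
move=> x d w; rewrite le_eqVlt => /predU1P[<- _|d0].
  by rewrite mulr0 !addr0 !subrr !mulr0.
case/andP; rewrite le_eqVlt => /predU1P[<- _|w0 w1].
  by rewrite mul0r !mulr_ge0 ?subr_ge0 ?plap_le ?invr_ge0 ?lerDl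
    ?(ltW d0) ?(ltW K0) ?(ltW C0) ?(ltW c0)//.
pose y := w * x; pose e := (1 + w) * d.
have e0 : 0 < e by rewrite mulr_gt0// addr_gt0.
have ye : y <= e + y by rewrite lerDr ltW.
have xd : x <= d + x by rewrite lerDr ltW.
have /andP[_] := H _ _ ye; have /andP[+ _] := H _ _ xd.
rewrite !addrK (addrC (w * x)) (addrC x d).
set M := Num.max `|d + x| _; set M2 := Num.max `|e + y| _.
move=> lo up.
have xM : `|x| <= M by rewrite le_max lexx orbT.
have dxM : `|d + x| <= M by rewrite le_max lexx.
have dM : d <= 2 * M.
  have := ler_norm (d + x); have := ler_norm (- x); rewrite normrN; lra.
have M0 : 0 < M by lra.
have yM2 : `|y| <= M2 by rewrite le_max lexx orbT.
have eyM2 : `|e + y| <= M2 by rewrite le_max lexx.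
have eM2 : e <= 2 * M2.
  have := ler_norm (e + y); have := ler_norm (- y); rewrite normrN; lra.
have ny : `|y| = w * `|x| by rewrite normrM gtr0_norm.
have M2M : M2 <= 5 * M.
  have yM : `|y| <= M by rewrite ny (le_trans _ xM)// ler_piMl.
  have e4M : e <= 4 * M by rewrite /e; nra.
  rewrite ge_max; apply/andP; split; last by lra.
  by rewrite (le_trans (ler_normD _ _))// (gtr0_norm e0); lra.
have MM2 : 3^-1 * (w * M) <= M2.
  have : w * M <= w * d + `|y|.
    rewrite ny -mulrDr ler_pM2l// ge_max lerDr (ltW d0) andbT.
    by rewrite (le_trans (ler_normD _ _))// gtr0_norm.
  have : w * d <= e by rewrite /e mulrDl mul1r lerDr ltW.
  lra.
have wM0 : 0 < 3^-1 * (w * M) by rewrite !mulr_gt0.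
(* For $p\le2$ the power of $M_2$ is controlled through the lower bound $wM/3$, which degenerates
   with $w$; the prefactor pays for this, as $w\,w^{p-2}=w^{p-1}\le1$. *)
have key : w * M2 `^ (p - 2) <= K * M `^ (p - 2).
  have [p2|/ltW p2] := leP 0 (p - 2).
    apply: (@le_trans _ _ (1 * (5 * M) `^ (p - 2))).
      apply: ler_pM => //; rewrite ?powR_ge0 ?(ltW w0)//.
      by apply: ge0_ler_powR; rewrite // ?nnegrE; lra.
    rewrite mul1r powRM ?(ltW M0)//; apply: ler_wpM2r; first exact: powR_ge0.
    by rewrite le_max lexx.
  apply: (@le_trans _ _ (w * (3^-1 * (w * M)) `^ (p - 2))).
    by rewrite ler_pM2l//; apply: le0_ger_powR.
  rewrite !powRM ?mulr_ge0 ?invr_ge0 ?(ltW w0) ?(ltW M0)// !mulrA.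
  apply: ler_wpM2r; first exact: powR_ge0.
  rewrite mulrAC; have -> : w * w `^ (p - 2) = w `^ (p - 1).
    have -> : p - 2 = (p - 1) - 1 by ring.
    by rewrite mulr_powRB1 ?subr_gt0// ltW.
  apply: (@le_trans _ _ (1 * 3^-1 `^ (p - 2))); last by rewrite mul1r le_max lexx orbT.
  apply: ler_wpM2r; first exact: powR_ge0.
  rewrite -[leRHS](powRr0 w); apply: ger_powR; first by rewrite w0.
  by rewrite subr_ge0 ltW.
rewrite -/y -/e.
apply: (@le_trans _ _ (w * (C * (e * M2 `^ (p - 2))))).
  by rewrite ler_pM2l//.
apply: (@le_trans _ _ (2 * C * K / c * (c * (d * M `^ (p - 2))))); last first.
  by apply: ler_wpM2l; rewrite // divr_ge0 ?mulr_ge0// ltW.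
have -> : 2 * C * K / c * (c * (d * M `^ (p - 2))) = (2 * d) * (C * (K * M `^ (p - 2))).
  by field; exact: lt0r_neq0.
have -> : w * (C * (e * M2 `^ (p - 2))) = e * (C * (w * M2 `^ (p - 2))) by ring.
apply: ler_pM; rewrite ?(ltW e0) ?mulr_ge0 ?powR_ge0 ?(ltW C0) ?(ltW w0)//.
  by rewrite /e; nra.
by rewrite ler_pM2l.
Qed.

Lemma is_derive_picone a b r : is_derive r 1 (picone p a b 1)
  (p * b * (h (a - b) * h r - h (a - b * r))).
Proof.
have d1 : is_derive r 1 ((fun t => `|t| `^ p) \o (fun t => a * 1 - b * t))
    (p * h (a * 1 - b * r) * - b).
  apply: is_derive1_comp; first exact: is_derive_norm_powR.
  by apply: is_derive_eq; rewrite add0r mul1r /GRing.scale/= mulr1.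
have d2 := is_derive_norm_powR p1 r.
have -> : picone p a b 1 =
   ((fun t => `|t| `^ p) \o (fun t => a * 1 - b * t)) -
   cst (h (a - b)) * (cst (a * `|1| `^ p) - cst b * (fun t : R => `|t| `^ p)).
  by apply/funext => t; rewrite /picone/=.
apply: is_derive_eq; rewrite !scaler0 !addr0 sub0r /GRing.scale/=; rewrite mulr1; ring.
Qed.

Lemma picone11 a b : picone p a b 1 1 = 0.
Proof. by rewrite /picone !mulr1 normr1 powR1 !mulr1 plap_mulr// subrr. Qed.

(** By homogeneity of $h$ the derivative at $x$ is $pb\,(h(x(a-b))-h(a-bx))$, and $x(a-b)\le a-bx$
    for $0<x<1$. *)
Lemma picone_antitone a b r v : 0 <= a -> 0 <= b -> 0 <= r -> r <= v -> v <= 1 ->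
  picone p a b 1 v <= picone p a b 1 r.
Proof.
move=> a0 b0 r0 rv v1.
have D x := is_derive_picone a b x.
apply: (@ler0_derive1_nincr R _ 0 1) => //.
- move=> x; rewrite in_itv/= => /andP[x0 x1].
  rewrite derive1E derive_val.
  apply: mulr_ge0_le0; first by rewrite mulr_ge0// ltW// (lt_trans ltr01).
  have -> : h (a - b) * h x = h (x * (a - b)).
    by rewrite plapM ?(ltW x0)// -ge0_plap ?(ltW x0)// mulrC.
  rewrite subr_le0.
  apply: plap_le; nra.
- by apply: derivable_within_continuous => x _; apply: ex_derive.
Qed.

(** The right side minus the left side vanishes at $r=1$ and is nonincreasing in $r$, by
    [plap_diff_scale]. The 2 in the constant stems from the derivative of $r^2$. *)
Lemma picone_sqr_le : exists2 C : R, 0 < C & forall a b r, 0 <= a -> 0 <= b ->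
  0 <= r <= 1 -> picone p a b 1 (r ^+ 2) <= C * picone p a b 1 r.
Proof.
have [C C0 H] := plap_diff_scale; exists (2 * C); first by rewrite mulr_gt0.
move=> a b r a0 b0 /andP[r0 r1].
have D x : is_derive x 1 (fun t : R => 2 * C * picone p a b 1 t - picone p a b 1 (t ^+ 2))
  (2 * C * (p * b * (h (a - b) * h x - h (a - b * x))) -
   (p * b * (h (a - b) * h (x ^+ 2) - h (a - b * x ^+ 2))) * (2 * x)).
  have Dx := is_derive_picone a b x.
  have D2 : is_derive x 1 (picone p a b 1 \o (fun t => t ^+ 2))
      ((p * b * (h (a - b) * h (x ^+ 2) - h (a - b * x ^+ 2))) * (2 * x)).
    apply: is_derive1_comp; first exact: is_derive_picone.
    by apply: is_derive_eq; rewrite /GRing.scale/= mulr1 -mulr2n mulr_natl.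
  have : is_derive x 1 (cst (2 * C) * picone p a b 1 -
      (picone p a b 1 \o (fun t => t ^+ 2)))
      (2 * C * (p * b * (h (a - b) * h x - h (a - b * x))) -
       (p * b * (h (a - b) * h (x ^+ 2) - h (a - b * x ^+ 2))) * (2 * x)).
    by apply: is_derive_eq; rewrite !scaler0 !addr0.
  exact.
rewrite -subr_ge0.
have <- : 2 * C * picone p a b 1 1 - picone p a b 1 (1 ^+ 2) = 0.
  by rewrite expr1n picone11 mulr0 subrr.
apply: (@ler0_derive1_nincr R
  (fun t : R => 2 * C * picone p a b 1 t - picone p a b 1 (t ^+ 2)) 0 1) => //.
- move=> x; rewrite in_itv/= => /andP[x0 x1].
  rewrite derive1E derive_val.
  have /(H ((a - b) * x) (a * (1 - x))) : 0 <= a * (1 - x) by rewrite mulr_ge0// subr_ge0 ltW.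
  move=> /(_ x); rewrite (ltW x0) (ltW x1) => /(_ isT).
  have -> : x * ((a - b) * x) + (1 + x) * (a * (1 - x)) = a - b * x ^+ 2 by ring.
  have -> : (a - b) * x + a * (1 - x) = a - b * x by ring.
  have -> : x * ((a - b) * x) = x ^+ 2 * (a - b) by ring.
  rewrite (mulrC (a - b) x) !plapM ?sqr_ge0 ?(ltW x0)//.
  rewrite -!ge0_plap ?sqr_ge0 ?(ltW x0)//.
  have pb : 0 <= p * b by rewrite mulr_ge0// ltW// (lt_trans ltr01).
  have -> : h (x ^+ 2) = h x * h x by rewrite expr2 plapM ?(ltW x0)// -ge0_plap ?(ltW x0).
  set B := h (a - b); set E := h _; set F := h x; set G := h _.
  move=> hh; rewrite -oppr_ge0.
  rewrite [leRHS](_ : _ = 2 * (p * b) * (C * (G - F * B) - x * (E - F * F * B))); last first.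
    by ring.
  by apply: mulr_ge0; [exact: mulr_ge0|rewrite subr_ge0].
- by apply: derivable_within_continuous => x _; apply: ex_derive.
Qed.
End picone_theory.

(** * Dyadic sums of truncations *)

(** The terms double as long as $2^k\le q$ and are halved afterwards, so two geometric series bound
    the sum uniformly in $N$ and $q$. *)
Lemma sum_dyadic_min_le4 {R : realFieldType} (N : nat) (q : R) : 0 < q ->
  \sum_(k < N) Num.min (q / 2 ^+ k) (2 ^+ k / q) <= 4.
Proof.
move=> q0.
(* Dropping the first term replaces [q] by [q / 2]; these bounds are stable under that. *)
suff [H1 H2] : (q <= 1 -> \sum_(k < N) Num.min (q / 2 ^+ k) (2 ^+ k / q) <= 2 * q)
    /\ (1 <= q -> \sum_(k < N) Num.min (q / 2 ^+ k) (2 ^+ k / q) <= 4 - 2 / q).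
  have [q1|q1] := leP q 1; first by apply: le_trans (H1 q1) _; lra.
  by apply: le_trans (H2 (ltW q1)) _; rewrite gerBl divr_ge0// ltW.
elim: N q q0 => [|N IH] q q0.
  rewrite big_ord0; split=> q1; first by lra.
  by rewrite subr_ge0 ler_pdivrMr//; lra.
have q20 : 0 < q / 2 by rewrite divr_gt0.
have {IH} [IH1 IH2] := IH _ q20.
rewrite big_ord_recl expr0 divr1.
have -> : \sum_(i < N) Num.min (q / 2 ^+ lift ord0 i) (2 ^+ lift ord0 i / q) =
    \sum_(i < N) Num.min (q / 2 / 2 ^+ i) (2 ^+ i / (q / 2)).
  apply: eq_bigr => i _; rewrite /= /bump/= exprS.
  have i0 : (2 : R) ^+ i != 0 by rewrite expf_neq0.
  by congr Num.min; field; rewrite ?i0// lt0r_neq0.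
split => q1.
  have -> : 2 * q = q + 2 * (q / 2) by field.
  by apply: lerD; [rewrite ge_min lexx|apply: IH1; lra].
apply: (@le_trans _ _ (1 / q + \sum_(i < N) Num.min (q / 2 / 2 ^+ i) (2 ^+ i / (q / 2)))).
  by rewrite lerD2r ge_min lexx orbT.
have [q2|q2] := leP q 2.
  apply: (@le_trans _ _ (1 / q + 2 * (q / 2))).
    by rewrite lerD2l; apply: IH1; lra.
  rewrite -subr_ge0.
  have -> : 4 - 2 / q - (1 / q + 2 * (q / 2)) = ((3 - q) * (q - 1)) / q.
    by field; exact: lt0r_neq0.
  by rewrite divr_ge0 ?mulr_ge0 ?(ltW q0)//; lra.
apply: (@le_trans _ _ (1 / q + (4 - 2 / (q / 2)))).
  by rewrite lerD2l; apply: IH2; lra.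
rewrite -subr_ge0.
have -> : 4 - 2 / q - (1 / q + (4 - 2 / (q / 2))) = 1 / q.
  by field; exact: lt0r_neq0.
by rewrite divr_ge0// ltW.
Qed.

(** The linear truncation [min (max (s - 1) 0) 1] would not do for [p < 2] and
    [a <> b]: it sends [(1 + e, 1)] to [(e, 0)], where [picone] is of order [e^p],
    while it is of order [e^2] at [(1 + e, 1)]. *)
Definition sqtrunc {R : realType} (s : R) : R := Num.min (s ^+ 2) 1.

Section dyadic.
Context {R : realType} {p : R}.
Hypothesis p1 : 1 < p.
Local Notation h := (plap p).
Implicit Types a b r s t k : R.

Let p0 : 0 < p. Proof. exact: lt_trans p1. Qed.

Lemma piconeZ a b k s t : 0 <= k ->
  picone p a b (k * s) (k * t) = k `^ p * picone p a b s t.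
Proof.
move=> k0; rewrite /picone.
have -> : a * (k * s) - b * (k * t) = k * (a * s - b * t) by ring.
by rewrite !normrM (ger0_norm k0) !powRM//; ring.
Qed.

Lemma picone_sym a b s t : picone p a b s t = picone p b a t s.
Proof.
rewrite /picone -(opprB b a) plapN -(opprB (b * t)) normrN; ring.
Qed.

Lemma piconeE a b s t : 0 < s -> picone p a b s t = s `^ p * picone p a b 1 (t / s).
Proof.
by move=> s0; rewrite -piconeZ ?ltW// mulr1 mulrC divfK// lt0r_neq0.
Qed.

Lemma picone00 a b : picone p a b 0 0 = 0.
Proof.
by rewrite /picone !mulr0 subr0 normr0 powR0 ?gt_eqF// !mulr0 subrr mulr0 subr0.
Qed.

(** Picone's inequality. Symmetry and homogeneity reduce it to $s=1\ge t$, where the gap is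
    nonincreasing in $t$ and vanishes at $t=1$. *)
Lemma picone_ge0 a b s t : 0 <= a -> 0 <= b -> 0 <= s -> 0 <= t ->
  0 <= picone p a b s t.
Proof.
move=> a0 b0 s0 t0; wlog ts : a b s t a0 b0 s0 t0 / t <= s => [H|].
  by have [ts|/ltW ts] := leP t s; [|rewrite picone_sym]; apply: H.
move: s0; rewrite le_eqVlt => /predU1P[s0|s0].
  have -> : t = 0 by apply/le_anti; rewrite t0 s0 ts.
  by rewrite -s0 picone00.
rewrite piconeE// mulr_ge0 ?powR_ge0// -(picone11 p1 a b).
by apply: picone_antitone; rewrite // ?divr_ge0 ?(ltW s0)// ler_pdivrMr// mul1r.
Qed.

(** The value is $s^p a\,(h(a)-h(a-b))$, and $h$ is strictly increasing. *)
Lemma picone_gt0 a b s : 0 < a -> 0 < b -> 0 < s -> 0 < picone p a b s 0.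
Proof.
move=> a0 b0 s0; rewrite piconeE// mulr_gt0 ?powR_gt0// mul0r.
rewrite /picone mulr0 subr0 !mulr1 normr1 powR1 normr0 powR0 ?gt_eqF// mulr0 subr0.
rewrite -plap_mulr// mulr1 -mulrBl mulr_gt0// subr_gt0 plap_lt//.
by rewrite gtrBl.
Qed.

Lemma sqtrunc_ge0 s : 0 <= sqtrunc s.
Proof. by rewrite le_min sqr_ge0 ler01. Qed.

Lemma sqtrunc0 : sqtrunc 0 = 0 :> R.
Proof. by rewrite /sqtrunc expr0n/= minEle ler01. Qed.

Lemma sqtrunc_ge1 s : 1 <= s -> sqtrunc s = 1.
Proof.
by move=> s1; apply/min_idPr; rewrite expr_ge1// (le_trans ler01).
Qed.

(** This exhibits the factor that [sum_dyadic_min_le4] sums over the levels. *)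
Lemma sqtrunc_scale s k : 0 < s -> 0 < k ->
  k * sqtrunc (s / k) = Num.min (s / k) (k / s) * s.
Proof.
move=> s0 k0; rewrite /sqtrunc minr_pMr ?minr_pMl ?ltW//.
congr Num.min; field; rewrite ?lt0r_neq0//.
Qed.

Lemma min_powR_le s k : 0 < s -> 0 < k ->
  Num.min (s / k) (k / s) `^ p <= Num.min (s / k) (k / s).
Proof.
move=> s0 k0; apply: ge1r_powR; last exact: ltW.
rewrite lt_min !divr_gt0//= ge_min ler_pdivrMr// ler_pdivrMr// !mul1r.
exact: le_total.
Qed.

Lemma sqtrunc_powR_le s k : 0 < s -> 0 < k ->
  k `^ p * sqtrunc (s / k) `^ p <= Num.min (s / k) (k / s) * s `^ p.
Proof.
move=> s0 k0; rewrite -powRM ?sqtrunc_ge0 ?(ltW k0)// sqtrunc_scale// powRM ?(ltW s0)//.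
  by apply: ler_wpM2r; rewrite ?powR_ge0// min_powR_le.
by rewrite le_min !divr_ge0// ltW.
Qed.

(** Truncation is monotone and only brings the ratio of the squares closer to 1. With
    [picone_antitone], the gap at the truncated pair is then controlled by the gap at the squared
    ratio. *)
Lemma sqtrunc_ratio s t k : 0 < s -> 0 <= t -> t <= s -> 0 < k ->
  (t / s) ^+ 2 <= sqtrunc (t / k) / sqtrunc (s / k) <= 1.
Proof.
move=> s0 t0 ts k0.
have S0 : 0 < sqtrunc (s / k) by rewrite lt_min ltr01 exprn_gt0 ?divr_gt0.
have tsk : t / k <= s / k by rewrite ler_pM2r ?invr_gt0.
have tk0 : 0 <= t / k by rewrite divr_ge0// ltW.
have sk0 : 0 <= s / k by rewrite divr_ge0// ltW.
rewrite ler_pdivlMr// ler_pdivrMr// mul1r; apply/andP; split; last first.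
  by apply: le_min2 => //; rewrite lerXn2r ?nnegrE.
have -> : (t / k) = (t / s) * (s / k) by field; rewrite !lt0r_neq0.
have ts0 : 0 <= t / s by rewrite divr_ge0// ltW.
rewrite [leRHS]/sqtrunc [(t / s * _) ^+ 2]exprMn le_min; apply/andP; split.
  by apply: ler_wpM2l; rewrite ?sqr_ge0 ?ge_min ?lexx.
rewrite mulr_ile1 ?sqr_ge0 ?sqtrunc_ge0//; last by rewrite ge_min lexx orbT.
by rewrite exprn_ile1// ler_pdivrMr// mul1r.
Qed.

(** Homogeneity extracts $(k\,\mathrm{sqtrunc}(s/k))^p$, which gives the minimum. What remains is
    the gap at the ratio of the truncations: [picone_antitone] passes to $(t/s)^2$ and
    [picone_sqr_le] to $t/s$. *)
Lemma picone_sqtrunc_le : exists2 C : R, 0 < C & forall a b s t k,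
  0 <= a -> 0 <= b -> 0 < s -> 0 <= t <= s -> 0 < k ->
  k `^ p * picone p a b (sqtrunc (s / k)) (sqtrunc (t / k)) <=
  C * Num.min (s / k) (k / s) * picone p a b s t.
Proof.
have [C C0 H] := picone_sqr_le p1; exists C => // a b s t k a0 b0 s0 /andP[t0 ts] k0.
have S0 : 0 < sqtrunc (s / k) by rewrite lt_min ltr01 exprn_gt0 ?divr_gt0.
have /andP[r1 r2] := sqtrunc_ratio s0 t0 ts k0.
rewrite piconeE// (piconeE _ _ _ s0) mulrA.
have P0 : 0 <= picone p a b 1 (t / s) by rewrite picone_ge0// divr_ge0// ltW.
have tsr : 0 <= t / s <= 1 by rewrite divr_ge0 ?(ltW s0)//= ler_pdivrMr// mul1r.
apply: (@le_trans _ _ (k `^ p * sqtrunc (s / k) `^ p * (C * picone p a b 1 (t / s)))).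
  apply: ler_wpM2l; first by rewrite mulr_ge0 ?powR_ge0.
  apply: le_trans (H _ _ _ a0 b0 tsr).
  by apply: picone_antitone => //; exact: sqr_ge0.
apply: (@le_trans _ _ (Num.min (s / k) (k / s) * s `^ p * (C * picone p a b 1 (t / s)))).
  by apply: ler_wpM2r; rewrite ?sqtrunc_powR_le ?mulr_ge0// ltW.
by rewrite le_eqVlt; apply/orP; left; apply/eqP; ring.
Qed.

Lemma sum_sqtrunc_powR_le (N : nat) (l s : R) : 0 < l -> 0 <= s ->
  \sum_(k < N) (l * 2 ^+ k) `^ p * sqtrunc (s / (l * 2 ^+ k)) `^ p <= 4 * s `^ p.
Proof.
move=> l0; rewrite le_eqVlt => /predU1P[<-|s0].
  rewrite powR0 ?gt_eqF// mulr0 big1// => k _.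
  by rewrite mul0r sqtrunc0 powR0 ?gt_eqF// mulr0.
apply: (@le_trans _ _ (\sum_(k < N) Num.min (s / l / 2 ^+ k) (2 ^+ k / (s / l)) * s `^ p)).
  apply: ler_sum => k _; have k0 : 0 < (2 : R) ^+ k by exact: exprn_gt0.
  apply: le_trans (sqtrunc_powR_le s0 (mulr_gt0 l0 k0)) _.
  rewrite ler_pM2r ?powR_gt0// le_eqVlt; apply/orP; left; apply/eqP.
  by congr Num.min; field; rewrite !lt0r_neq0.
by rewrite -mulr_suml ler_pM2r ?powR_gt0// sum_dyadic_min_le4// divr_gt0.
Qed.

(** The edge part of the truncation estimate. The constant is uniform in $a,b$, which later are the
    values of $u$ at the two ends of an edge. *)
Lemma sum_picone_sqtrunc_le : exists2 C : R, 0 < C & forall (N : nat) (l a b s t : R),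
  0 < l -> 0 <= a -> 0 <= b -> 0 <= s -> 0 <= t ->
  \sum_(k < N) (l * 2 ^+ k) `^ p *
    picone p a b (sqtrunc (s / (l * 2 ^+ k))) (sqtrunc (t / (l * 2 ^+ k)))
  <= C * picone p a b s t.
Proof.
have [C C0 H] := picone_sqtrunc_le; exists (C * 4); first by rewrite mulr_gt0.
move=> N l a b s t l0 a0 b0 s0 t0; wlog ts : a b s t a0 b0 s0 t0 / t <= s => [W|].
  have [ts|/ltW ts] := leP t s; first exact: W.
  by rewrite picone_sym; under eq_bigr do rewrite picone_sym; apply: W.
move: s0; rewrite le_eqVlt => /predU1P[s0|s0].
  have -> : t = 0 by apply/le_anti; rewrite t0 s0 ts.
  by rewrite -s0 picone00 mulr0 big1// => k _; rewrite mul0r sqtrunc0 picone00 mulr0.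
apply: (@le_trans _ _ (\sum_(k < N) Num.min (s / l / 2 ^+ k) (2 ^+ k / (s / l)) *
    (C * picone p a b s t))).
  apply: ler_sum => k _; have k0 : 0 < (2 : R) ^+ k by exact: exprn_gt0.
  have tss : 0 <= t <= s by rewrite t0.
  move: (H a b s t _ a0 b0 s0 tss (mulr_gt0 l0 k0)).
  move/le_trans; apply.
  rewrite le_eqVlt; apply/orP; left; apply/eqP; rewrite mulrCA mulrA.
  by congr (_ * _ * _); congr Num.min; field; rewrite !lt0r_neq0.
rewrite -mulr_suml mulrAC [leRHS]mulrC ler_wpM2r ?mulr_ge0 ?picone_ge0 ?(ltW C0) ?(ltW s0)//.
by rewrite sum_dyadic_min_le4// divr_gt0.
Qed.
End dyadic.

(** * Absolutely summable real families *)

Lemma ge0_esumZl {R : realType} {T : choiceType} (a : T -> R) (k : R) :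
  0 <= k -> (forall x, 0 <= a x) ->
  (\esum_(x in [set: T]) (k * a x)%:E = k%:E * \esum_(x in [set: T]) (a x)%:E)%E.
Proof.
(* One inequality suffices: applied to $k^{-1}$ it yields the other. *)
suff H (k' : R) (a' : T -> R) : 0 < k' -> (forall x, 0 <= a' x) ->
    (\esum_(x in [set: T]) (k' * a' x)%:E <= k'%:E * \esum_(x in [set: T]) (a' x)%:E)%E.
  rewrite le_eqVlt => /predU1P[<- a0|k0 a0].
    by rewrite mul0e esum1// => x _; rewrite mul0r.
  apply/le_anti; rewrite H//= -lee_pdivlMl//.
  have := H k^-1 (fun x => k * a x); rewrite invr_gt0 => /(_ k0).
  have E x : k^-1 * (k * a x) = a x by rewrite mulKf// gt_eqF.
  by under eq_esum do rewrite E; apply => x; rewrite mulr_ge0// ltW.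
move=> k0 a0; apply: ge_ereal_sup => _ [A [finA _] <-].
rewrite fsbig_finite//=; under eq_bigr do rewrite EFinM.
rewrite -ge0_sume_distrr//; last by move=> i _; rewrite lee_fin.
apply: lee_wpmul2l; first by rewrite lee_fin ltW.
rewrite -fsbig_finite//; apply: ereal_sup_ubound.
by exists A.
Qed.

Section abs_sum_theory.
Context {R : realType} {T : countType}.
Implicit Types F G : T -> R.

(** The condition under which [abs_sum] is linear; without it [fine] may replace an infinite part by
    0. *)
Definition rsummable F := (\esum_(x in [set: T]) (`|F x|)%:E < +oo)%E.

Lemma rsummable_le F G : (forall x, `|F x| <= `|G x|) -> rsummable G -> rsummable F.
Proof. by move=> FG; apply: le_lt_trans; apply: le_esum => x _; rewrite lee_fin. Qed.

Lemma rsummableD F G : rsummable F -> rsummable G -> rsummable (fun x => F x + G x).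
Proof. exact: (@summableD T R setT (EFin \o F) (EFin \o G)). Qed.

Lemma rsummableZ k F : rsummable F -> rsummable (fun x => k * F x).
Proof.
move=> FF; rewrite /rsummable; under eq_esum do rewrite normrM.
by rewrite ge0_esumZl// lte_mul_pinfty.
Qed.

Lemma rsummableN F : rsummable F -> rsummable (fun x => - F x).
Proof. by move=> sF; apply: rsummable_le sF => x; rewrite normrN. Qed.

Lemma rsummable0 : rsummable (fun=> 0).
Proof. by rewrite /rsummable esum1// => x _; rewrite normr0. Qed.

Lemma rsummable_sum (I : Type) (s : seq I) (F : I -> T -> R) :
  (forall i, rsummable (F i)) -> rsummable (fun x => \sum_(i <- s) F i x).
Proof.
move=> H; elim: s => [|i s IH].
  by apply: rsummable_le rsummable0 => x; rewrite big_nil normr0.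
by under [X in rsummable X]eq_fun do rewrite big_cons; exact: rsummableD.
Qed.

Lemma rsummable_pos F : rsummable F -> rsummable (fun x => Num.max (F x) 0).
Proof.
by apply: rsummable_le => x; case: (leP (F x) 0) => // _; rewrite normr0.
Qed.

Lemma ge0_abs_sum F : (forall x, 0 <= F x) ->
  abs_sum F = fine (\esum_(x in [set: T]) (F x)%:E).
Proof.
move=> F0; rewrite /abs_sum [X in _ - fine X]esum1 ?subr0.
  by congr fine; apply: eq_esum => x _; rewrite max_l.
by move=> x _; rewrite max_r// oppr_le0.
Qed.

Lemma ge0_esum_abs_sum F : (forall x, 0 <= F x) -> rsummable F ->
  (\esum_(x in [set: T]) (F x)%:E = (abs_sum F)%:E)%E.
Proof.
move=> F0; rewrite /rsummable; under eq_esum do rewrite ger0_norm//.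
move=> h; rewrite ge0_abs_sum// fineK// ge0_fin_numE//.
by apply: esum_ge0 => x _; rewrite lee_fin.
Qed.

(** $F$ and $G$ need not be the positive and negative parts of $F-G$; [esumB] states that both
    decompositions have the same difference of sums. *)
Lemma ge0_abs_sumB F G : rsummable F -> rsummable G ->
  (forall x, 0 <= F x) -> (forall x, 0 <= G x) ->
  abs_sum (fun x => F x - G x) = abs_sum F - abs_sum G.
Proof.
move=> sF sG F0 G0.
have := @esumB R T setT (EFin \o F) (EFin \o G) sF sG.
have l0 (H : T -> R) : (forall x, 0 <= H x) -> forall i, setT i -> (0 <= (EFin \o H) i)%E.
  by move=> H0 i _; rewrite lee_fin.
move=> /(_ (l0 _ F0) (l0 _ G0)).
rewrite [in X in _ = X -> _](ge0_esum_abs_sum F0 sF) (ge0_esum_abs_sum G0 sG).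
have sFG : rsummable (fun x => F x - G x) by apply: rsummableD => //; exact: rsummableN.
rewrite /abs_sum; set a := \esum_(i in _) _; set b := \esum_(i in _) _.
have aE : (\esum_(y in [set: T]) (Num.max (F y - G y) 0)%:E)%E = a.
  by apply: eq_esum => x _; rewrite funeposE/= -EFin_max.
have bE : (\esum_(y in [set: T]) (Num.max (- (F y - G y)) 0)%:E)%E = b.
  by apply: eq_esum => x _; rewrite funenegE/= -EFin_max.
rewrite aE bE.
have fin (H : T -> R) : rsummable H ->
    (\esum_(y in [set: T]) (Num.max (H y) 0)%:E)%E \is a fin_num.
  by move=> /rsummable_pos sH; rewrite ge0_esum_abs_sum// => y; rewrite le_max lexx orbT.
have fa : a \is a fin_num by rewrite -aE fin.
have fb : b \is a fin_num by rewrite -bE fin//; exact: rsummableN.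
by rewrite -{1}(fineK fa) -{1}(fineK fb) => -[].
Qed.

Lemma abs_sumE F : rsummable F ->
  abs_sum F = abs_sum (fun x => Num.max (F x) 0) - abs_sum (fun x => Num.max (- F x) 0).
Proof.
by move=> sF; rewrite {1}/abs_sum -!ge0_abs_sum// => x; rewrite le_max lexx orbT.
Qed.

Lemma eq_abs_sum F G : F =1 G -> abs_sum F = abs_sum G.
Proof. by move=> /funext ->. Qed.

Lemma abs_sumN F : abs_sum (fun x => - F x) = - abs_sum F.
Proof.
rewrite /abs_sum opprB; congr (_ - fine _).
by apply: eq_esum => x _; rewrite opprK.
Qed.

(** $F+G$ is the difference of the nonnegative families $F^++G^+$ and $F^-+G^-$, so [ge0_abs_sumB]
    reduces the claim to additivity for nonnegative families. *)
Lemma abs_sumD F G : rsummable F -> rsummable G ->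
  abs_sum (fun x => F x + G x) = abs_sum F + abs_sum G.
Proof.
move=> sF sG; pose P (H : T -> R) x := Num.max (H x) 0; pose N (H : T -> R) x := Num.max (- H x) 0.
have PN (H : T -> R) x : H x = P H x - N H x.
  by rewrite /P /N; case: (leP (H x) 0); case: (leP (- H x) 0); lra.
have P0 (H : T -> R) x : 0 <= P H x by rewrite le_max lexx orbT.
have N0 (H : T -> R) x : 0 <= N H x by rewrite le_max lexx orbT.
have sP H : rsummable H -> rsummable (P H) by exact: rsummable_pos.
have sN H : rsummable H -> rsummable (N H).
  by move=> /rsummableN; exact: rsummable_pos.
have ge0D (H K : T -> R) : (forall x, 0 <= H x) -> (forall x, 0 <= K x) ->
    rsummable H -> rsummable K -> abs_sum (fun x => H x + K x) = abs_sum H + abs_sum K.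
  move=> H0 K0 sH sK; apply: EFin_inj.
  rewrite [RHS]EFinD -(ge0_esum_abs_sum H0 sH) -(ge0_esum_abs_sum K0 sK).
  rewrite -ge0_esum_abs_sum.
  - by under eq_esum do rewrite EFinD; rewrite esumD// => x _; rewrite lee_fin.
  - by move=> x; rewrite addr_ge0.
  - exact: rsummableD.
rewrite (@eq_abs_sum _ (fun x => (P F x + P G x) - (N F x + N G x))); last first.
  by move=> x; rewrite {1}(PN F) {1}(PN G); ring.
rewrite ge0_abs_sumB; do ?[by apply: rsummableD; auto|by move=> x; rewrite addr_ge0].
by rewrite !ge0D; auto; rewrite (abs_sumE sF) (abs_sumE sG); ring.
Qed.

Lemma abs_sumZ k F : rsummable F -> abs_sum (fun x => k * F x) = k * abs_sum F.
Proof.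
move=> sF.
wlog k0 : k / 0 <= k => [H|].
  have [/H//|k0] := leP 0 k.
  rewrite (@eq_abs_sum _ (fun x => - ((- k) * F x))); last by move=> x; rewrite mulNr opprK.
  by rewrite abs_sumN H ?mulNr ?opprK// oppr_ge0 ltW.
have P (G : T -> R) : rsummable G -> fine (\esum_(y in [set: T]) (Num.max (k * G y) 0)%:E) =
   k * fine (\esum_(y in [set: T]) (Num.max (G y) 0)%:E).
  move=> /rsummable_pos sG.
  have G0 x : 0 <= Num.max (G x) 0 by rewrite le_max lexx orbT.
  rewrite (ge0_esum_abs_sum G0 sG)/=.
  rewrite (@eq_esum _ _ _ _ (fun x => (k * Num.max (G x) 0)%:E)); last first.
    by move=> x _; rewrite maxr_pMr// mulr0.
  by rewrite ge0_esumZl// (ge0_esum_abs_sum G0 sG).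
rewrite /abs_sum P// mulrBr; congr (_ - _).
by rewrite -P; [under [in RHS]eq_esum do rewrite mulrN|exact: rsummableN].
Qed.

Lemma abs_sum0 : abs_sum (fun _ : T => 0 : R) = 0.
Proof. by rewrite ge0_abs_sum// esum1. Qed.

Lemma abs_sum_sum (I : Type) (s : seq I) (F : I -> T -> R) :
  (forall i, rsummable (F i)) ->
  abs_sum (fun x => \sum_(i <- s) F i x) = \sum_(i <- s) abs_sum (F i).
Proof.
move=> H; elim: s => [|i s IH].
  rewrite big_nil (@eq_abs_sum _ (fun=> 0)) ?abs_sum0// => x.
  by rewrite big_nil.
rewrite big_cons -IH -abs_sumD//; last exact: rsummable_sum.
by apply: eq_abs_sum => x; rewrite big_cons.
Qed.

Lemma abs_sum_ge0 F : (forall x, 0 <= F x) -> 0 <= abs_sum F.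
Proof.
move=> F0; rewrite ge0_abs_sum// fine_ge0// esum_ge0// => x _.
by rewrite lee_fin.
Qed.

Lemma le_abs_sum F G : (forall x, F x <= G x) -> rsummable F -> rsummable G ->
  abs_sum F <= abs_sum G.
Proof.
move=> FG sF sG; rewrite -subr_ge0 -abs_sumN -abs_sumD//; last exact: rsummableN.
by apply: abs_sum_ge0 => x; rewrite subr_ge0.
Qed.

Lemma term_le_abs_sum F x : (forall x, 0 <= F x) -> rsummable F -> F x <= abs_sum F.
Proof.
move=> F0 sF; rewrite -lee_fin -ge0_esum_abs_sum//.
rewrite (esumID [set x]); last by move=> i _; rewrite lee_fin.
rewrite setTI esum_set1 ?lee_fin// leeDl// esum_ge0// => i _.
by rewrite lee_fin.
Qed.
End abs_sum_theory.

(** * Sums over pairs of vertices *)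

Section abs_sum_prod.
Context {R : realType} {X : countType}.
Implicit Types F : X * X -> R.

Let swap_bij : set_bij [set: X * X] [set: X * X] (fun z => (z.2, z.1)).
Proof.
split => //; first by move=> [x y] [x' y'] _ _ [-> ->].
by move=> [x y] _; exists (y, x).
Qed.

Lemma rsummable_swap F : rsummable F -> rsummable (fun z => F (z.2, z.1)).
Proof. by rewrite /rsummable (reindex_esum _ _ _ _ swap_bij). Qed.

Lemma abs_sum_swap F : abs_sum (fun z => F (z.2, z.1)) = abs_sum F.
Proof.
by rewrite /abs_sum [in RHS](reindex_esum _ _ _ _ swap_bij)
  [in X in _ = _ - X](reindex_esum _ _ _ _ swap_bij).
Qed.

(** Tonelli for families with finitely many nonzero rows. The rows themselves may be infinite, since
    the graph need not be locally finite. *)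
Lemma esum_prod_finite (s : seq X) (a : X * X -> R) : uniq s -> (forall z, 0 <= a z) ->
  (forall x y, x \notin s -> a (x, y) = 0) ->
  (\esum_(z in [set: X * X]) (a z)%:E =
   \sum_(x <- s) \esum_(y in [set: X]) (a (x, y))%:E)%E.
Proof.
move=> us a0 as0.
have -> : [set: X * X] = [set: X] `*`` (fun=> [set: X]) by apply/seteqP; split.
rewrite (@eq_esum _ _ _ _ (fun z => (a (z.1, z.2))%:E)); last by case.
rewrite -(@esum_esum _ _ _ _ _ (fun x y => (a (x, y))%:E)); last by move=> i j _ _; rewrite lee_fin.
have ge0 x : (0 <= \esum_(y in [set: X]) (a (x, y))%:E)%E.
  by apply: esum_ge0 => y _; rewrite lee_fin.
transitivity (\esum_(x in [set` s]) \esum_(y in [set: X]) (a (x, y))%:E)%E.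
  rewrite [RHS]esum_mkcond; apply: eq_esum => x _; case: ifPn => //.
  rewrite notin_setE/= => /negP xs; rewrite esum1// => y _.
  by rewrite as0.
by rewrite esum_fset -?fsbig_seq//; exact: finite_seq.
Qed.

Lemma rsummable_prod_finite (s : seq X) F : uniq s ->
  (forall x y, x \notin s -> F (x, y) = 0) ->
  (forall x, rsummable (fun y => F (x, y))) -> rsummable F.
Proof.
move=> us Fs H; rewrite /rsummable (esum_prod_finite us)//.
  by apply/lte_sum_pinfty => x _; exact: H.
by move=> x y xs; rewrite Fs// normr0.
Qed.

Lemma abs_sum_prod_finite (s : seq X) F : uniq s ->
  (forall x y, x \notin s -> F (x, y) = 0) ->
  (forall x, rsummable (fun y => F (x, y))) ->
  abs_sum F = \sum_(x <- s) abs_sum (fun y => F (x, y)).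
Proof.
move=> us Fs H.
have E (G : X * X -> R) : (forall x y, x \notin s -> G (x, y) = 0) ->
   (forall x, rsummable (fun y => G (x, y))) ->
  fine (\esum_(z in [set: X * X]) (Num.max (G z) 0)%:E) =
  \sum_(x <- s) fine (\esum_(y in [set: X]) (Num.max (G (x, y)) 0)%:E).
  move=> Gs sG; rewrite (esum_prod_finite us).
  - rewrite -sum_fine// => x _.
    have m0 y : 0 <= Num.max (G (x, y)) 0 by rewrite le_max lexx orbT.
    by rewrite (ge0_esum_abs_sum m0)//; apply: rsummable_pos; exact: sG.
  - by move=> z; rewrite le_max lexx orbT.
  - by move=> x y xs; rewrite Gs// maxxx.
rewrite /abs_sum E// (E (fun z => - F z)); last 2 first.
- by move=> x y xs; rewrite Fs// oppr0.
- by move=> x; apply: rsummableN; exact: H.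
by rewrite -sumrB.
Qed.
End abs_sum_prod.

(** * The energy of finitely supported functions *)

(** The list may exceed the support, so that one list serves a function and all its truncations. *)
Lemma CcP {R : realType} {X : countType} (phi : X -> R) :
  Cc phi <-> exists2 s : seq X, uniq s & forall x, x \notin s -> phi x = 0.
Proof.
split=> [Cphi|[s _ H]].
  exists (finmap.enum_fset (fset_set [set x | phi x != 0])); first exact: finmap.fset_uniq.
  move=> x; apply: contraNeq => xphi.
  by have := in_fset_set Cphi x; rewrite mem_set// => ->.
apply: (@sub_finite_set _ _ [set` s]) (finite_seq s) => x /=.
by apply: contraNT => /H ->.
Qed.

Lemma powR_norm_subr_le {R : realType} (p x y : R) : 0 <= p ->
  `|x - y| `^ p <= 2 `^ p * (`|x| `^ p + `|y| `^ p).
Proof.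
move=> p0.
have M0 : 0 <= Num.max `|x| `|y| by rewrite le_max normr_ge0.
apply: (@le_trans _ _ ((2 * Num.max `|x| `|y|) `^ p)).
  apply: ge0_ler_powR; rewrite ?nnegrE ?mulr_ge0//.
  rewrite (le_trans (ler_normB _ _))// mulr_natl mulr2n lerD//.
    by rewrite le_max lexx.
  by rewrite le_max lexx orbT.
rewrite powRM//; apply: ler_wpM2l; first exact: powR_ge0.
by case: (leP `|x| `|y|) => _; rewrite ?lerDl ?lerDr powR_ge0.
Qed.

Section graph.
Context {R : realType} {X : countType} {p : R} {b : X -> X -> R} {c : X -> R}.
Hypothesis p1 : 1 < p.
Hypothesis gb : connected_graph b.
Local Notation h := (plap p).
Implicit Types (phi psi u : X -> R) (s : seq X).

Let p0 : 0 < p. Proof. exact: lt_trans p1. Qed.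

Lemma rsummable_graph x : rsummable (b x).
Proof.
rewrite /rsummable; under eq_esum do rewrite ger0_norm ?(graph_ge0 gb)//.
exact: graph_sum.
Qed.

(** Dominated by $2^p b(x,y)(|\varphi(x)|^p+|\varphi(y)|^p)$: the first part has finitely many
    nonzero rows, each summable by [graph_sum], and the second is its mirror image. *)
Lemma rsummable_edge_energy phi : Cc phi ->
  rsummable (fun z : X * X => b z.1 z.2 * `|phi z.1 - phi z.2| `^ p).
Proof.
move=> /CcP[s us s0].
have s1 : rsummable (fun z : X * X => b z.1 z.2 * `|phi z.1| `^ p).
  apply: (rsummable_prod_finite us) => [x y xs|x] /=.
    by rewrite s0// normr0 powR0 ?gt_eqF// mulr0.
  under [X in rsummable X]eq_fun do rewrite mulrC.
  exact: rsummableZ (rsummable_graph x).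
have s2 := rsummable_swap s1.
apply: rsummable_le (rsummableZ (2 `^ p) (rsummableD s1 s2)) => -[x y] /=.
have B0 := graph_ge0 gb.
rewrite normrM (ger0_norm (B0 _ _)) (ger0_norm (powR_ge0 _ _)).
apply: le_trans (ler_norm _); rewrite (graph_sym gb y x).
rewrite -mulrDr mulrCA; apply: ler_wpM2l => //.
by apply: powR_norm_subr_le; exact: ltW.
Qed.

Lemma energyE phi s : uniq s -> (forall x, x \notin s -> phi x = 0) ->
  energy p b c phi =
  (2^-1 * abs_sum (fun z : X * X => b z.1 z.2 * `|phi z.1 - phi z.2| `^ p)
   + \sum_(x <- s) c x * `|phi x| `^ p)%:E.
Proof.
move=> us s0; have Cphi : Cc phi by apply/CcP; exists s.
rewrite /energy (ge0_esum_abs_sum _ (rsummable_edge_energy Cphi)); last first.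
  by move=> z; rewrite mulr_ge0 ?powR_ge0// (graph_ge0 gb).
rewrite -EFinM -EFinD; congr (_ + _)%:E; rewrite (fsbig_seq _ _ us)/=.
by apply/esym/fsbig_widen => // x [_ /= /negP xs]; rewrite s0//= normr0 powR0 ?gt_eqF// mulr0.
Qed.

Lemma energy_fin_num phi : Cc phi -> energy p b c phi \is a fin_num.
Proof. by move=> /CcP[s us s0]; rewrite (energyE us s0). Qed.

(** The reverse triangle inequality on every edge. It permits passing to nonnegative functions. *)
Lemma energy_norm_le phi : Cc phi ->
  (energy p b c (fun x => `|phi x|)%R <= energy p b c phi)%E.
Proof.
move=> Cphi; have /CcP[s us s0] := Cphi.
have ns0 x : x \notin s -> `|phi x| = 0 by move=> /s0 ->; rewrite normr0.
have Cn : Cc (fun x => `|phi x|) by apply/CcP; exists s.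
rewrite (energyE us s0) (energyE us ns0) lee_fin.
under [X in _ + X <= _]eq_bigr do rewrite normr_id.
rewrite lerD2r ler_pM2l ?invr_gt0//.
apply: le_abs_sum (rsummable_edge_energy Cn) (rsummable_edge_energy Cphi).
move=> z; apply: ler_wpM2l; first exact: graph_ge0.
by apply: ge0_ler_powR; rewrite ?nnegrE ?(ltW p0)// ler_dist_dist.
Qed.

(** * The ground state representation *)

Section ground_state.
Context {m u : X -> R}.
Hypothesis m0 : forall x, 0 < m x.
Hypothesis u0 : forall x, 0 < u x.
Hypothesis Fu : Fdom p b u.

Definition picone_edge psi (z : X * X) : R :=
  b z.1 z.2 * picone p (u z.1) (u z.2) (psi z.1) (psi z.2).

(** The coefficient of $|\psi(x)|^p$ in the vertex part of the representation. *)
Definition energy'_weight x : R := m x * energy' p m b c u x * u x.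

Let flux_summable x : rsummable (fun y => b x y * h (u x - u y)).
Proof.
rewrite /rsummable.
under eq_esum do rewrite normrM (ger0_norm (graph_ge0 gb _ _)) (norm_plap p1).
exact: Fu.
Qed.

Lemma energy'_weightE x : energy'_weight x =
  u x * abs_sum (fun y => b x y * h (u x - u y)) + c x * u x `^ p.
Proof.
have u00 := ltW (u0 x).
have -> : u x `^ p = h (u x) * u x by rewrite plap_mulr// ger0_norm.
rewrite /energy'_weight /energy' /plap.
by field; rewrite lt0r_neq0.
Qed.

(** Half of the first-order part of an edge term: as $h$ is odd and $b$ symmetric, the other half is
    its value at the swapped pair. Taken alone, it has finitely many nonzero rows, and these are
    summable because $u\in\mathcal F(X)$. *)
Let flux psi (z : X * X) : R := b z.1 z.2 * h (u z.1 - u z.2) * (u z.1 * `|psi z.1| `^ p).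

Let fluxE psi s : uniq s -> (forall x, x \notin s -> psi x = 0) ->
  rsummable (flux psi) /\
  abs_sum (flux psi) =
    \sum_(x <- s) u x * `|psi x| `^ p * abs_sum (fun y => b x y * h (u x - u y)).
Proof.
move=> us s0.
have F0 x y : x \notin s -> flux psi (x, y) = 0.
  by move=> xs; rewrite /flux/= s0// normr0 powR0 ?gt_eqF// !mulr0.
have Fx x : (fun y => flux psi (x, y)) =
    (fun y => u x * `|psi x| `^ p * (b x y * h (u x - u y))).
  by apply/funext => y; rewrite /flux/= mulrC.
have sF x : rsummable (fun y => flux psi (x, y)).
  by rewrite Fx; apply: rsummableZ.
split; first exact: rsummable_prod_finite F0 sF.
rewrite (abs_sum_prod_finite us F0 sF).
by apply: eq_bigr => x _; rewrite Fx abs_sumZ.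
Qed.

Let edge_energyE psi z :
  b z.1 z.2 * `|u z.1 * psi z.1 - u z.2 * psi z.2| `^ p =
  picone_edge psi z + (flux psi z + flux psi (z.2, z.1)).
Proof.
rewrite /picone_edge /flux /picone/= (graph_sym gb z.2) -(opprB (u z.1) (u z.2)) plapN.
by ring.
Qed.

Lemma rsummable_picone_edge psi : Cc psi -> rsummable (picone_edge psi).
Proof.
move=> /CcP[s us s0].
have [sF _] := fluxE us s0.
have CU : Cc (fun x => u x * psi x).
  by apply/CcP; exists s => // x /s0 ->; rewrite mulr0.
have sFF := rsummableD sF (rsummable_swap sF).
have -> : picone_edge psi = (fun z => b z.1 z.2 * `|u z.1 * psi z.1 - u z.2 * psi z.2| `^ p +
    - (flux psi z + flux psi (z.2, z.1))).
  by apply/funext => z; rewrite edge_energyE addrK.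
by apply: rsummableD; [exact: (rsummable_edge_energy CU)|exact: rsummableN].
Qed.

(** In the sum of [edge_energyE] over all pairs, the two fluxes have equal sums and cancel the
    factor $1/2$; by [fluxE] and [energy'_weightE] they combine with the potential into the vertex
    part. *)
Lemma ground_state_representation psi s : uniq s -> (forall x, x \notin s -> psi x = 0) ->
  energy p b c (fun x => u x * psi x) =
  (2^-1 * abs_sum (picone_edge psi) + \sum_(x <- s) energy'_weight x * `|psi x| `^ p)%:E.
Proof.
move=> us s0.
have us0 x : x \notin s -> u x * psi x = 0 by move=> /s0 ->; rewrite mulr0.
have Cpsi : Cc psi by apply/CcP; exists s.
have [sF EF] := fluxE us s0.
have sG := rsummable_swap sF.
rewrite (energyE us us0); congr EFin.
rewrite (eq_abs_sum (edge_energyE psi)) abs_sumD; last 2 first.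
- exact: rsummable_picone_edge.
- exact: rsummableD.
rewrite abs_sumD// abs_sum_swap EF mulrDr -addrA; congr (_ + _).
rewrite -[X in _ * X + _]mulr2n -[X in _ * X + _]mulr_natl mulKf// -big_split/=.
apply: eq_bigr => x _; rewrite energy'_weightE normrM (gtr0_norm (u0 x)) powRM ?(ltW (u0 x))//.
by ring.
Qed.

Hypothesis Su : forall x, 0 <= energy' p m b c u x.

Lemma energy'_weight_ge0 x : 0 <= energy'_weight x.
Proof. by rewrite mulr_ge0 ?mulr_ge0// ltW. Qed.

Lemma picone_edge_ge0 psi z : (forall x, 0 <= psi x) -> 0 <= picone_edge psi z.
Proof.
move=> psi0; rewrite mulr_ge0 ?(graph_ge0 gb)//.
by apply: picone_ge0 => //; exact: ltW.
Qed.

Lemma energy_eq0 phi : infinite_set [set: X] -> Cc phi ->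
  (energy p b c phi <= 0)%E -> phi = cst 0.
Proof.
(* A vertex off the support exists because $X$ is infinite; paths to it will lead to a
   contradiction. *)
move=> infX Cphi E0; have /CcP[s us s0] := Cphi.
have [x0 x0s] : exists x0, x0 \notin s.
  apply: contrapT => /forallNP H; apply: infX.
  apply: sub_finite_set (finite_seq s) => x _ /=.
  by apply/negP => /negP; exact: H.
pose psi x := `|phi x| / u x.
have psi0 x : 0 <= psi x by rewrite divr_ge0// ltW.
have spsi x : x \notin s -> psi x = 0 by move=> /s0; rewrite /psi => ->; rewrite normr0 mul0r.
have Cpsi : Cc psi by apply/CcP; exists s.
have E1 := le_trans (energy_norm_le Cphi) E0.
have Epsi : (fun x => `|phi x|) = (fun x => u x * psi x).
  by apply/funext => x; rewrite mulrC divfK// lt0r_neq0.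
move: E1; rewrite Epsi (ground_state_representation us spsi) lee_fin => E1.
have W0 : 0 <= \sum_(x <- s) energy'_weight x * `|psi x| `^ p.
  by apply: sumr_ge0 => x _; rewrite mulr_ge0 ?powR_ge0 // energy'_weight_ge0.
have S0 : abs_sum (picone_edge psi) <= 0 by lra.
(* An edge from $\psi>0$ to $\psi=0$ would put a positive term into a nonnegative sum that is at
   most 0. *)
have edge x y : 0 < psi x -> 0 < b x y -> psi y != 0.
  move=> px bxy; apply/eqP => py.
  have := term_le_abs_sum (x, y) (fun z => picone_edge_ge0 z psi0) (rsummable_picone_edge Cpsi).
  rewrite leNgt => /negP; apply; apply: (le_lt_trans S0).
  by rewrite /picone_edge/= py mulr_gt0// picone_gt0.
have walk t x : 0 < psi x -> path (fun v w => 0 < b v w) x t -> 0 < psi (last x t).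
  elim: t x => //= y t IH x px /andP[bxy pt]; apply: IH => //.
  by rewrite lt0r psi0 andbT; exact: edge bxy.
apply/funext => x; apply/eqP; apply: contraT => px.
have [t [pt lt]] := graph_conn gb x x0.
have psix : 0 < psi x by rewrite divr_gt0// normr_gt0.
by have := walk t x psix pt; rewrite lt spsi// ltxx.
Qed.
End ground_state.
End graph.

(** * Maz'ya's truncation inequality *)

(** After the ground state representation of every energy, the sum over $k$ is estimated separately
    on each edge and at each vertex. The constant precedes the graph, hence depends on $p$ only. *)
Lemma sum_energy_sqtrunc_le {R : realType} (p : R) : 1 < p ->
  exists2 C : R, 0 < C & forall (X : countType) (m : X -> R) (b : X -> X -> R)
      (c u psi : X -> R) (N : nat) (l : R),
    connected_graph b -> (forall x, 0 < m x) -> (forall x, 0 < u x) ->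
    supersolution p m b c u -> Cc psi -> (forall x, 0 <= psi x) -> 0 < l ->
    \sum_(k < N) (l * 2 ^+ k) `^ p *
      fine (energy p b c (fun x => u x * sqtrunc (psi x / (l * 2 ^+ k)))) <=
    C * fine (energy p b c (fun x => u x * psi x)).
Proof.
move=> p1; have [C C0 HC] := sum_picone_sqtrunc_le p1.
(* $C$ serves the edges, 4 the vertices ([sum_sqtrunc_powR_le]). *)
exists (Num.max C 4); first by rewrite lt_max C0.
move=> X m b c u psi N l gb m0 u0 [Fu Su] Cpsi psi0 l0.
have /CcP[s us s0] := Cpsi.
pose psi_ (k : nat) x := sqtrunc (psi x / (l * 2 ^+ k)).
have s_0 k x : x \notin s -> psi_ k x = 0.
  by move=> /s0; rewrite /psi_ => ->; rewrite mul0r sqtrunc0.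
have C_ k : Cc (psi_ k) by apply/CcP; exists s => //; exact: s_0.
pose W := energy'_weight (p := p) (b := b) (c := c) (m := m) (u := u).
have W0 x : 0 <= W x := energy'_weight_ge0 m0 u0 Su x.
pose S psi := abs_sum (picone_edge (p := p) (b := b) (u := u) psi).
have E psi' : (forall x, x \notin s -> psi' x = 0) ->
    fine (energy p b c (fun x => u x * psi' x)) =
    2^-1 * S psi' + \sum_(x <- s) W x * `|psi' x| `^ p.
  by move=> H; rewrite (ground_state_representation p1 gb m0 u0 Fu us H).
rewrite E// (eq_bigr (fun k : 'I_N => 2^-1 * ((l * 2 ^+ k) `^ p * S (psi_ k)) +
    \sum_(x <- s) W x * ((l * 2 ^+ k) `^ p * psi_ k x `^ p))); last first.
  move=> k _; rewrite E; last exact: s_0.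
  rewrite mulrDr mulrCA; congr (_ + _); rewrite mulr_sumr; apply: eq_bigr => x _.
  by rewrite mulrCA ger0_norm// sqtrunc_ge0.
rewrite big_split/= -mulr_sumr mulrDr.
apply: lerD.
  rewrite [leRHS]mulrCA ler_pM2l ?invr_gt0//.
  apply: (@le_trans _ _ (C * S psi)); last first.
    apply: ler_wpM2r; last by rewrite le_max lexx.
    by apply: abs_sum_ge0 => z; exact: picone_edge_ge0.
  rewrite (eq_bigr (fun k : 'I_N => abs_sum (fun z => (l * 2 ^+ k) `^ p *
      picone_edge (p := p) (b := b) (u := u) (psi_ k) z))); last first.
    by move=> k _; rewrite abs_sumZ//; exact: rsummable_picone_edge.
  rewrite -abs_sum_sum; last first.
    by move=> k; apply: rsummableZ; exact: rsummable_picone_edge.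
  rewrite /S -abs_sumZ; last exact: rsummable_picone_edge.
  apply: le_abs_sum => [z||].
  - rewrite /picone_edge mulrCA; under eq_bigr do rewrite mulrCA.
    rewrite -mulr_sumr; apply: ler_wpM2l; first exact: graph_ge0.
    by apply: HC => //; exact: ltW.
  - apply: rsummable_sum => k; apply: rsummableZ; exact: rsummable_picone_edge.
  - by apply: rsummableZ; exact: rsummable_picone_edge.
rewrite exchange_big/= mulr_sumr; apply: ler_sum => x _.
rewrite -mulr_sumr mulrCA; apply: ler_wpM2l => //.
apply: le_trans (sum_sqtrunc_powR_le p1 N l0 (psi0 x)) _.
rewrite ger0_norm//; apply: ler_wpM2r; first exact: powR_ge0.
by rewrite le_max lexx orbT.
Qed.

Lemma dyadic_level {R : realFieldType} (N : nat) (l y : R) : l <= y -> y < l * 2 ^+ N ->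
  exists2 k : 'I_N, l * 2 ^+ k <= y & y < 2 * (l * 2 ^+ k).
Proof.
move=> ly; elim: N => [|N IH]; first by rewrite expr0 mulr1 ltNge ly.
have [/IH[k k1 k2] _|yN yN1] := ltP y (l * 2 ^+ N).
  by exists (widen_ord (leqnSn N) k).
by exists ord_max => //=; rewrite mulrCA -exprS.
Qed.

(** The finitely many positive values of $\psi$ on $s$ lie in a compact subinterval of $(0,\infty)$,
    so finitely many levels suffice. *)
Lemma seq_dyadic_levels {R : realType} {T : eqType} (s : seq T) (psi : T -> R) :
  exists l N, 0 < l /\ forall x, x \in s -> 0 < psi x ->
    exists2 k : 'I_N, l * 2 ^+ k <= psi x & psi x < 2 * (l * 2 ^+ k).
Proof.
have [l [M [l0 H]]] : exists l M : R, 0 < l /\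
    forall x, x \in s -> 0 < psi x -> l <= psi x <= M.
  elim: s => [|y s [l [M [l0 H]]]]; first by exists 1, 1.
  have [y0|y0] := leP (psi y) 0.
    exists l, M; split => // x; rewrite inE => /predU1P[->|]; last exact: H.
    by rewrite ltNge y0.
  exists (Num.min l (psi y)), (Num.max M (psi y)); split; first by rewrite lt_min l0.
  move=> x; rewrite inE => /predU1P[->|xs] x0.
    by rewrite ge_min le_max lexx !orbT.
  by have /andP[? ?] := H x xs x0; apply/andP; rewrite ge_min le_max; split; apply/orP; left.
(* This many levels reach beyond $M$, since $M/l<n<2^n$ for this $n$. *)
exists l, (Num.bound (M / l)); split => // x xs x0.
have /andP[lx xM] := H x xs x0.
apply: dyadic_level => //; apply: (le_lt_trans xM); rewrite mulrC -ltr_pdivrMr//.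
have Ml0 : 0 <= M / l by rewrite divr_ge0 ?(ltW l0)// (le_trans (ltW x0)).
apply: lt_trans (archi_boundP Ml0) _.
by rewrite -natrX ltr_nat ltn_expl.
Qed.

(** * Comparison of the capacity norm with the Hardy norm *)

Section norms.
Context {R : realType} {X : countType} {p : R} {m : X -> R} {b : X -> X -> R} {c u g : X -> R}.
Hypothesis p1 : 1 < p.
Hypothesis infX : infinite_set [set: X].
Hypothesis m0 : forall x, 0 < m x.
Hypothesis gb : connected_graph b.
Hypothesis E0 : forall phi : X -> R, Cc phi -> (0 <= energy p b c phi)%E.
Hypothesis u0 : forall x, 0 < u x.
Hypothesis Su : supersolution p m b c u.

Let p0 : 0 < p. Proof. exact: lt_trans p1. Qed.

Let admissible (K : set X) phi := Cc phi /\ forall x, \1_K x * u x <= phi x.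

Let w_ge0 (r x : R) y : 0 <= m y * x `^ r * `|g y|.
Proof. by rewrite !mulr_ge0 ?powR_ge0 ?(ltW (m0 y)). Qed.

Let admissible_cap K : finite_set K -> admissible K (fun x => \1_K x * u x).
Proof.
move=> finK; split=> //; apply: sub_finite_set finK => x /=.
rewrite indicE; have [/set_mem//|_] := boolP (x \in K).
by rewrite mul0r eqxx.
Qed.

Let cap_ge0 K : (0 <= cap p b c u K)%E.
Proof. by apply: le_ereal_inf_tmp => _ [phi [/E0 ? _] <-]. Qed.

Let cap_le K phi : admissible K phi -> (cap p b c u K <= energy p b c phi)%E.
Proof. by move=> H; apply: ereal_inf_lbound; exists phi. Qed.

Let cap_fin_num K : finite_set K -> cap p b c u K \is a fin_num.
Proof.
move=> finK; have [Ck Hk] := admissible_cap finK.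
rewrite ge0_fin_numE//; apply: (@le_lt_trans _ _ (energy p b c (fun x => \1_K x * u x))).
  exact: cap_le.
by rewrite ltey_eq energy_fin_num.
Qed.

Lemma cap_norm_ge0 : (0 <= cap_norm p m b c u g)%E.
Proof.
apply: ereal_sup_ubound; exists set0; first exact: finite_set0.
by rewrite /cap_quot fsbig_set0 mul0e.
Qed.

Lemma cap_norm_admissible r K phi : cap_norm p m b c u g = r%:E -> finite_set K ->
  admissible K phi ->
  \sum_(x \in K) m x * u x `^ p * `|g x| <= r * fine (energy p b c phi).
Proof.
move=> nr finK aphi; have r0 : 0 <= r by rewrite -lee_fin -nr cap_norm_ge0.
have S0 : 0 <= \sum_(x \in K) m x * u x `^ p * `|g x| by apply: fsumr_ge0.
have : (cap_quot p m b c u g K <= r%:E)%E.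
  by rewrite -nr; apply: ereal_sup_ubound; exists K.
have := cap_le aphi; rewrite /cap_quot.
have := cap_ge0 K; rewrite -(fineK (cap_fin_num finK)).
rewrite -(fineK (energy_fin_num p1 gb aphi.1)) !lee_fin.
set q := fine _; set S := \sum_(x \in K) _ in S0 *; move=> q0 qE.
(* A zero capacity has inverse $+\infty$, so a positive numerator would contradict the finiteness of
   the norm; a zero numerator makes the claim trivial. *)
rewrite inver; case: eqP => [_|/eqP qn0].
  move: S0; rewrite le_eqVlt => /predU1P[<- _|S0].
    by rewrite mulr_ge0// (le_trans q0).
  by rewrite gt0_muley ?lte_fin// leye_eq.
rewrite lee_fin ler_pdivrMr ?lt0r ?qn0// => /le_trans; apply.
exact: ler_wpM2l.
Qed.

(** The supremum of the empty set is $-\infty$, so a function of nonzero energy must be exhibited;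
    by [energy_eq0] any nonzero one will do. *)
Lemma hardy_norm_ge0 : (0 <= hardy_norm p m b c g)%E.
Proof.
have [x0 _] : [set: X] !=set0 by apply/set0P/negP => /eqP X0; apply: infX; rewrite X0.
pose phi x : R := \1_[set x0] x * u x.
have [Cphi _] := admissible_cap (finite_set1 x0).
have En0 : energy p b c phi != 0%E.
  apply/eqP => Ez; have := energy_eq0 p1 gb m0 u0 Su.1 Su.2 infX Cphi.
  rewrite Ez => /(_ (lexx _)) /(congr1 (@^~ x0)) /eqP; apply/negP.
  by rewrite /= indicE mem_set//= mul1r lt0r_neq0.
apply: le_ereal_sup_tmp; eexists; first by exists phi.
apply: mule_ge0; first by rewrite lee_fin; apply: fsumr_ge0.
by rewrite inve_ge0 E0.
Qed.

Lemma cap_norm_le_hardy_norm : (cap_norm p m b c u g <= hardy_norm p m b c g)%E.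
Proof.
have [->|Hoo] := eqVneq (hardy_norm p m b c g) +oo%E; first exact: leey.
have Hfin : hardy_norm p m b c g \is a fin_num.
  by rewrite ge0_fin_numE ?hardy_norm_ge0// ltey.
set r := fine (hardy_norm p m b c g); have rE := fineK Hfin; rewrite -/r in rE.
have r0 : 0 <= r by rewrite fine_ge0 ?hardy_norm_ge0.
rewrite -rE; apply: ge_ereal_sup => _ [K finK <-]; rewrite /= in finK.
set S := \sum_(x \in K) m x * u x `^ p * `|g x|.
have S0 : 0 <= S by apply: fsumr_ge0.
have key phi : admissible K phi -> S <= r * fine (energy p b c phi).
  (* A competitor of zero energy vanishes, which is compatible with $\varphi\ge u>0$ on $K$ only if
     $K$ is empty, and then $S=0$. *)
  move=> [Cphi Kphi]; have [Ez|En0] := eqVneq (energy p b c phi) 0%E.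
    have phi0 : phi = cst 0.
      by apply: (energy_eq0 p1 gb m0 u0 Su.1 Su.2 infX Cphi); rewrite Ez.
    rewrite Ez mulr0 /S fsbig1// => x Kx; have := Kphi x.
    by rewrite phi0 indicE mem_set//= mul1r leNgt u0.
  have e0 : 0 < fine (energy p b c phi).
    by rewrite fine_gt0// lt0e En0 E0//= ltey_eq energy_fin_num.
  set T := \sum_(x \in [set: X]) m x * `|phi x| `^ p * `|g x|.
  have ST : S <= T.
    have /CcP[s _ s0] := Cphi.
    have Kphi_gt0 x : K x -> u x <= phi x.
      by move=> Kx; have := Kphi x; rewrite indicE mem_set//= mul1r.
    rewrite /T -(@fsbig_widen _ _ _ _ [set` s])//; last first.
      move=> x [_ /= /negP xs]; rewrite s0//= normr0 powR0 ?mulr0 ?mul0r//.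
      by rewrite gt_eqF.
    rewrite -lee_fin -!fsumEFin//; last exact: finite_seq.
    apply: (@le_trans _ _ (\sum_(x \in K) (m x * `|phi x| `^ p * `|g x|)%:E)%E).
      apply: lee_fsum => // x Kx; rewrite lee_fin.
      apply: ler_wpM2r => //; apply: ler_wpM2l; first exact: ltW.
      apply: ge0_ler_powR; rewrite ?nnegrE ?(ltW (u0 x)) ?(ltW p0)//.
      by rewrite (le_trans (Kphi_gt0 x Kx))// ler_norm.
    apply: lee_fsum_nneg_subset => //; first exact: finite_seq.
      move=> x /set_mem Kx; apply/mem_set => /=; apply: contraT => /s0 phi0.
      by have := Kphi_gt0 x Kx; rewrite phi0 leNgt u0.
    by move=> x _; rewrite lee_fin.
  apply: (le_trans ST); rewrite -ler_pdivrMr//.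
  rewrite -lee_fin rE; apply: le_ereal_sup_tmp.
  eexists; first by exists phi.
  rewrite -{2}(fineK (energy_fin_num p1 gb Cphi)) inver gt_eqF//.
have [Sz|Sn0] := eqVneq S 0; first by rewrite /cap_quot -/S Sz mul0e lee_fin.
have {}S0 : 0 < S by rewrite lt0r Sn0.
(* Dividing by $r$ turns [key] into a positive lower bound for the capacity, so the quotient becomes
   one of real numbers. *)
have r1 : 0 < r.
  rewrite lt0r r0 andbT; apply/eqP => rz; have := key _ (admissible_cap finK).
  by rewrite rz mul0r leNgt S0.
have : ((S / r)%:E <= cap p b c u K)%E.
  apply: le_ereal_inf_tmp => _ [phi aphi <-].
  rewrite -(fineK (energy_fin_num p1 gb aphi.1)) lee_fin ler_pdivrMr// mulrC.
  exact: key.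
rewrite /cap_quot -/S -(fineK (cap_fin_num finK)) lee_fin => Sq.
have q0 := lt_le_trans (divr_gt0 S0 r1) Sq.
by rewrite inver gt_eqF// lee_fin ler_pdivrMr// mulrC -ler_pdivrMr.
Qed.

(** The truncation inequality enters as a hypothesis; the factor $2^p$ is the loss from replacing
    $\psi$ by its dyadic level. *)
Lemma hardy_norm_le_cap_norm (C : R) : 0 < C ->
  (forall (psi : X -> R) N l, Cc psi -> (forall x, 0 <= psi x) -> 0 < l ->
    \sum_(k < N) (l * 2 ^+ k) `^ p *
      fine (energy p b c (fun x => u x * sqtrunc (psi x / (l * 2 ^+ k)))) <=
    C * fine (energy p b c (fun x => u x * psi x))) ->
  (hardy_norm p m b c g <= (2 `^ p * C)%:E * cap_norm p m b c u g)%E.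
Proof.
move=> C0 HC; have Cp0 : 0 < 2 `^ p * C by rewrite mulr_gt0// powR_gt0.
have [->|Hoo] := eqVneq (cap_norm p m b c u g) +oo%E.
  by rewrite gt0_muley ?lte_fin// leey.
have Hfin : cap_norm p m b c u g \is a fin_num.
  by rewrite ge0_fin_numE ?cap_norm_ge0// ltey.
set r := fine (cap_norm p m b c u g); have rE := esym (fineK Hfin); rewrite -/r in rE.
have r0 : 0 <= r by rewrite fine_ge0 ?cap_norm_ge0.
rewrite rE -EFinM; apply: ge_ereal_sup => _ [phi [Cphi En0] <-].
have Efin := energy_fin_num (c := c) p1 gb Cphi.
have e0 : 0 < fine (energy p b c phi).
  by rewrite fine_gt0// lt0e En0 E0//= ltey_eq Efin.
rewrite -(fineK Efin) inver gt_eqF// lee_fin ler_pdivrMr//.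
have /CcP[s us s0] := Cphi.
(* Thus $u\psi=|\varphi|$, with $\psi\ge0$. *)
pose psi x := `|phi x| / u x.
have psi0 x : 0 <= psi x by rewrite divr_ge0// ltW.
have spsi x : x \notin s -> psi x = 0 by move=> /s0; rewrite /psi => ->; rewrite normr0 mul0r.
have Cpsi : Cc psi by apply/CcP; exists s.
have Epsi : (fun x => u x * psi x) = (fun x => `|phi x|).
  by apply/funext => x; rewrite mulrC divfK// lt0r_neq0.
have [l [N [l0 H]]] := seq_dyadic_levels s psi.
pose lam (k : nat) : R := l * 2 ^+ k.
have lam0 k : 0 < lam k by rewrite mulr_gt0// exprn_gt0.
pose w x := m x * u x `^ p * `|g x|.
have w0 x : 0 <= w x by exact: w_ge0.
(* The single level with $\lambda_k\le\psi(x)<2\lambda_k$ already dominates $\psi(x)^p$. *)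
have psi_le x : x \in s -> psi x `^ p <= \sum_(k < N) 2 `^ p * lam k `^ p * ((lam k <= psi x)%R)%:R.
  move=> xs; have t0 (k : 'I_N) : 0 <= 2 `^ p * lam k `^ p * ((lam k <= psi x)%R)%:R.
    by rewrite !mulr_ge0 ?powR_ge0.
  have [px|px] := leP (psi x) 0.
    rewrite (_ : psi x `^ p = 0) ?sumr_ge0//.
    by rewrite (@le_anti _ _ (psi x) 0) ?px ?psi0// powR0// gt_eqF.
  have [k k1 k2] := H x xs px.
  rewrite (bigD1 k)//= -/(lam k) k1 mulr1 -powRM ?(ltW (lam0 k))//.
  rewrite -[leLHS]addr0 lerD ?sumr_ge0//.
  by apply: ge0_ler_powR; rewrite ?nnegrE ?psi0 ?(ltW k2) ?(ltW p0) ?(mulr_ge0 _ (ltW (lam0 k))).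
rewrite -(@fsbig_widen _ _ _ _ [set` s]) -?fsbig_seq//=; last first.
  by move=> x [_ /= /negP xs]; rewrite s0//= normr0 powR0 ?mulr0 ?mul0r// gt_eqF.
apply: (@le_trans _ _ (\sum_(x <- s) w x *
    \sum_(k < N) 2 `^ p * lam k `^ p * ((lam k <= psi x)%R)%:R)).
  rewrite big_seq [leRHS]big_seq; apply: ler_sum => x xs.
  have -> : `|phi x| = u x * psi x by rewrite mulrC divfK// lt0r_neq0.
  rewrite powRM ?(ltW (u0 x))//.
  rewrite [leLHS](_ : _ = w x * psi x `^ p); last by rewrite /w; ring.
  by apply: ler_wpM2l => //; exact: psi_le.
under eq_bigr do rewrite mulr_sumr.
rewrite exchange_big/=.
apply: (@le_trans _ _ (\sum_(k < N) 2 `^ p * lam k `^ p *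
    (r * fine (energy p b c (fun x => u x * sqtrunc (psi x / lam k)))))).
  apply: ler_sum => k _.
  rewrite [leLHS](_ : _ = 2 `^ p * lam k `^ p *
      \sum_(x \in [set` [seq x <- s | lam k <= psi x]]) w x); last first.
    rewrite -fsbig_seq ?filter_uniq//= big_filter [in RHS]big_mkcond/= mulr_sumr.
    by apply: eq_bigr => x _; case: ifP => _; rewrite ?mulr1 ?mulr0// mulrC.
  apply: ler_wpM2l; first by rewrite mulr_ge0 ?powR_ge0.
  (* The truncation equals 1 on $\{\psi\ge\lambda_k\}$ and is nonnegative elsewhere, so $u$ times it
     is a competitor for the capacity of this level set. *)
  apply: cap_norm_admissible => //.
  split.
    apply/CcP; exists s => // x /spsi ->.
    by rewrite mul0r sqtrunc0 mulr0.
  move=> x; rewrite mulrC indicE; apply: ler_wpM2l; first exact: ltW.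
  have [/set_mem/=|_] := boolP (x \in _); last exact: sqtrunc_ge0.
  rewrite mem_filter => /andP[lx _].
  by rewrite sqtrunc_ge1// ler_pdivlMr// mul1r.
rewrite [leLHS](_ : _ = 2 `^ p * r * \sum_(k < N) lam k `^ p *
    fine (energy p b c (fun x => u x * sqtrunc (psi x / lam k)))); last first.
  by rewrite mulr_sumr; apply: eq_bigr => k _; ring.
rewrite (_ : 2 `^ p * C * r * _ = 2 `^ p * r * (C * fine (energy p b c phi))); last by ring.
apply: ler_wpM2l; first by rewrite mulr_ge0 ?powR_ge0.
apply: le_trans (HC psi N l Cpsi psi0 l0) _.
(* The energy bound is in terms of $|\varphi|$; [energy_norm_le] returns to $\varphi$. *)
rewrite ler_pM2l// Epsi -lee_fin fineK// ?fineK//.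
  exact: energy_norm_le.
apply: energy_fin_num => //; apply/CcP; exists s => // x /s0 ->.
by rewrite normr0.
Qed.
End norms.

Theorem theorem3p1 (R : realType) (p : R) (hp : 1 < p) :
  exists Cp : R,
    forall (X : countType) (m : X -> R) (b : X -> X -> R) (c : X -> R),
      infinite_set [set: X] ->
      (forall x, 0 < m x) ->
      connected_graph b ->
      (forall phi : X -> R, Cc phi -> (0 <= energy p b c phi)%E) ->
      forall g u : X -> R,
        (forall x, 0 < u x) ->
        supersolution p m b c u ->
        (cap_norm p m b c u g <= hardy_norm p m b c g)%E /\
        (hardy_norm p m b c g <= Cp%:E * cap_norm p m b c u g)%E.
Proof.
have [C C0 HC] := sum_energy_sqtrunc_le hp; exists (2 `^ p * C).
move=> X m b c infX m0 gb E0 g u u0 Su; split.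
  exact: cap_norm_le_hardy_norm.
apply: hardy_norm_le_cap_norm => // psi N l Cpsi psi0 l0.
exact: HC gb m0 u0 Su Cpsi psi0 l0.
Qed.
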